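(* For all real $t>0$ and all integers $k\ge1$, $$\left|\frac{\widetilde{R}_{k+1}(t)}{\widetilde{T}_k(t)}\right| < \eta_k\,\sqrt{\pi k}.$$
   Context: For integers $k\ge1$, $\eta_k = 1/(1-2^{1-2k})$. $B_{2j}(u)$ is the Bernoulli polynomial. $\log$ is the principal branch of the logarithm on $\mathbb{C}\setminus(-\infty,0]$. $\ln\Gamma$ denotes the analytic function on $\mathbb{C}\setminus(-\infty,0]$ with $\exp(\ln\Gamma(z))=\Gamma(z)$ that is real and equal to $\log(\Gamma(x))$ for real $x>0$. For integers $j\ge 1$, $\widehat{T}_j(z) = \frac{B_{2j}(\frac12)}{2j(2j-1)z^{2j-1}}$, and for integers $k\ge 1$ and $z\in\mathbb{C}$ with $\Re(z)\ge0$, $z\neq0$, the remainder $\widehat{R}_k(z)$ is defined by $$\ln\Gamma(z+\tfrac12) = z\log z - z + \tfrac12\log(2\pi) + \sum_{j=1}^{k-1}\widehat{T}_j(z) + \widehat{R}_k(z).$$ For real $t>0$, $\widetilde{T}_j(t) := \tfrac12|\widehat{T}_j(t)| = \frac{|B_{2j}(\frac12)|}{4j(2j-1)t^{2j-1}}$ and $\widetilde{R}_{k}(t) := \Im\left(\tfrac12\widehat{R}_{k}(it)\right)$. These are the terms and remainder in the expansion $$\vartheta(t) = \frac{t}{2} \log\left(\frac{t}{2\pi e}\right) - \frac{\pi}{8} + \frac{\arctan(e^{-\pi t})}{2} + \sum_{j=1}^{k-1}\widetilde{T}_j(t) + \widetilde{R}_{k}(t)$$ of the Riemann-Siegel theta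 function $\vartheta(t) = \arg\Gamma\left(\frac{it}{2}+\frac14\right) - \frac{t}{2}\log\pi$ (argument chosen so that $\vartheta$ is continuous on $\mathbb{R}$ with $\vartheta(0)=0$). *)

(* Defs.v *)
(* Standard-library reals with Coquelicot. *)
From Stdlib Require Export Reals Factorial Lra Lia.
From Coquelicot Require Export Coquelicot.

Open Scope R_scope.

(** * Bernoulli polynomials *)

(* [bernoulli_upto n i] is the Bernoulli number B_i for i <= n, tabulated from
   B_0 = 1 and sum_{i <= m} 'C(m+1, i) B_i = 0 for m >= 1
   (see [bernoulli_rec]); in particular B_1 = -1/2. *)
Fixpoint bernoulli_upto (n : nat) : nat -> R :=
  match n with
  | O => fun _ => 1
  | S m => fun i =>
      if Nat.leb i m then bernoulli_upto m i
      else - (sum_f_R0 (fun l => Binomial.C (m + 2) l * bernoulli_upto m l) m)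
             / INR (m + 2)
  end.

Definition bernoulli (n : nat) : R := bernoulli_upto n n.

Definition bernoulli_poly (n : nat) (u : R) : R :=
  sum_f_R0 (fun i => Binomial.C n i * bernoulli i * u ^ (n - i)) n.

Lemma bernoulli_upto_stable (n i : nat) :
  (i <= n)%nat -> bernoulli_upto n i = bernoulli i.
Proof.
  intros Hi. induction n as [|n IH].
  - replace i with 0%nat by lia. reflexivity.
  - destruct (Nat.eq_dec i (S n)) as [->|Hne]; [reflexivity|].
    simpl. replace (Nat.leb i n) with true
      by (symmetry; apply Nat.leb_le; lia).
    apply IH; lia.
Qed.

Lemma bernoulli_rec (m : nat) : (1 <= m)%nat ->
  sum_f_R0 (fun i => Binomial.C (m + 1) i * bernoulli i) m = 0.
Proof.
  destruct m as [|m]; [lia|intros _].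
  rewrite tech5.
  assert (E : bernoulli (S m)
    = - (sum_f_R0 (fun l => Binomial.C (m + 2) l * bernoulli l) m) / INR (m + 2)).
  { unfold bernoulli at 1. cbn [bernoulli_upto].
    replace (Nat.leb (S m) m) with false
      by (symmetry; apply Nat.leb_gt; lia).
    do 2 f_equal. apply sum_eq. intros i Hi.
    now rewrite bernoulli_upto_stable. }
  rewrite E. replace (S m + 1)%nat with (m + 2)%nat by lia.
  assert (Hb : Binomial.C (m + 2) (S m) = INR (m + 2)).
  { unfold Binomial.C. replace (m + 2 - S m)%nat with 1%nat by lia.
    replace (m + 2)%nat with (S (S m)) by lia.
    rewrite (fact_simpl (S m)), mult_INR. simpl (Factorial.fact 1).
    change (INR 1) with 1. field. apply INR_fact_neq_0. }
  rewrite Hb. field. apply not_0_INR. lia.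
Qed.

(** * Complex exponential and principal logarithm *)

Definition Cexp (z : C) : C := (exp (Re z) * cos (Im z), exp (Re z) * sin (Im z)).

(* Principal argument, in (-PI, PI]; meaningful for z <> 0. *)
Definition Carg (z : C) : R :=
  if Rle_dec 0 (Im z) then acos (Re z / Cmod z) else - acos (Re z / Cmod z).

Definition Clog (z : C) : C := (ln (Cmod z), Carg z).

Lemma Re_div_Cmod_bound (z : C) : z <> 0 -> -1 <= Re z / Cmod z <= 1.
Proof.
  intros Hz. pose proof (proj1 (Cmod_gt_0 z) Hz) as Hp.
  pose proof (re_le_Cmod z) as H. apply Rabs_le_between in H.
  split; [apply Rle_div_r | apply Rle_div_l]; lra.
Qed.

Lemma Cexp_Clog (z : C) : z <> 0 -> Cexp (Clog z) = z.
Proof.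
  intros Hz. pose proof (proj1 (Cmod_gt_0 z) Hz) as Hp.
  pose proof (Re_div_Cmod_bound z Hz) as Hb.
  assert (Hs : Cmod z * sqrt (1 - (Re z / Cmod z)²) = Rabs (Im z)).
  { rewrite <- (sqrt_Rsqr (Cmod z)) at 1 by lra.
    rewrite <- sqrt_mult_alt by apply Rle_0_sqr.
    rewrite <- sqrt_Rsqr_abs. f_equal.
    transitivity (Cmod z ^ 2 - Re z ^ 2).
    - unfold Rsqr. field. lra.
    - rewrite Cmod2_alt. unfold Rsqr. ring. }
  unfold Cexp, Clog; simpl. rewrite exp_ln by assumption.
  unfold Carg. destruct (Rle_dec 0 (Im z)) as [Hi|Hi].
  - rewrite cos_acos, sin_acos, Hs, Rabs_pos_eq by assumption.
    destruct z as [x y]; simpl in *. f_equal. field. lra.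
  - rewrite cos_neg, sin_neg, cos_acos, sin_acos by assumption.
    rewrite Ropp_mult_distr_r_reverse, Hs, Rabs_left by lra.
    destruct z as [x y]; simpl in *. f_equal; [field|]; lra.
Qed.

Lemma Im_Clog_bound (z : C) : z <> 0 -> - PI < Im (Clog z) <= PI.
Proof.
  intros Hz. pose proof (Re_div_Cmod_bound z Hz) as Hb.
  pose proof (acos_bound (Re z / Cmod z)) as Ha. pose proof PI_RGT_0 as Hpi.
  simpl. unfold Carg. destruct (Rle_dec 0 (Im z)) as [Hi|Hi]; [lra|].
  split; [|lra].
  destruct (Req_dec (acos (Re z / Cmod z)) PI) as [E|E]; [|lra].
  exfalso.
  assert (Hc : Re z / Cmod z = -1) by (rewrite <- (cos_acos _ Hb), E, cos_PI; reflexivity).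
  pose proof (proj1 (Cmod_gt_0 z) Hz) as Hp.
  assert (Hr : Re z = - Cmod z).
  { transitivity (Re z / Cmod z * Cmod z); [field; lra|rewrite Hc; ring]. }
  pose proof (Cmod2_alt z) as H2. rewrite Hr in H2.
  assert (Im z ^ 2 = 0) by lra. nra.
Qed.

(** * The Gamma function and its logarithm *)

Fixpoint rising (z : C) (n : nat) : C :=
  match n with
  | O => RtoC 1
  | S m => (rising z m * (z + INR m))%C
  end.

(* [is_Gamma z w] means Gamma(z) = w, by Euler's limit
   Gamma(z) = lim n! n^z / (z (z+1) ... (z+n)),
   valid at every z other than 0, -1, -2, ... *)
Definition is_Gamma (z w : C) : Prop :=
  filterlim
    (fun n : nat => (INR (Factorial.fact n) * Cexp (z * ln (INR n)) / rising z (n + 1))%C)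
    eventually (@locally C_UniformSpace w).

(* C minus the half-line (-oo, 0]. *)
Definition slit_plane (z : C) : Prop := ~ (Im z = 0 /\ Re z <= 0).

(* These conditions determine [L] uniquely on [slit_plane]. *)
Record is_lnGamma (L : C -> C) : Prop := {
  lnGamma_analytic :
    forall z : C, slit_plane z -> @ex_derive C_AbsRing C_NormedModule L z;
  lnGamma_exp :
    forall z : C, slit_plane z -> is_Gamma z (Cexp (L z));
  lnGamma_real :
    forall x : R, 0 < x ->
      exists g : R, is_Gamma (RtoC x) (RtoC g) /\ L (RtoC x) = RtoC (ln g)
}.

(** * Asymptotic expansions *)

Definition eta (k : nat) : R := / (1 - powerRZ 2 (1 - 2 * Z.of_nat k)).

(* [That], [Ttilde] are meant for j >= 1; [Rhat], [Rtilde] for k >= 1. *)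
Definition That (j : nat) (z : C) : C :=
  (RtoC (bernoulli_poly (2 * j) (1 / 2))
     / (RtoC (2 * INR j * (2 * INR j - 1)) * z ^ (2 * j - 1)))%C.

(* The remainder, solved for from
   lnGamma (z + 1/2) = z log z - z + log (2 pi) / 2
                       + sum_{1 <= j <= k-1} That j z + Rhat k z;
   [sum_n_m _ 1 0] is the empty sum. *)
Definition Rhat (lnGamma : C -> C) (k : nat) (z : C) : C :=
  (lnGamma (z + RtoC (1 / 2))
     - (z * Clog z - z + RtoC (1 / 2 * ln (2 * PI))
        + @sum_n_m C_AbelianMonoid (fun j => That j z) 1 (k - 1)))%C.

Definition Ttilde (j : nat) (t : R) : R := 1 / 2 * Cmod (That j (RtoC t)).

Definition Rtilde (lnGamma : C -> C) (k : nat) (t : R) : R :=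
  Im (RtoC (1 / 2) * Rhat lnGamma k (Ci * RtoC t))%C.

(* Main.v *)
Require Import Defs.
Open Scope R_scope.

(** On the critical line everything is visible in the argument alone.  Euler's
    limit formula shows that the argument of Gamma(1/2 + it) is the limit of
      t ln n - sum_{m <= n} atan (t / (m + 1/2)),
    a midpoint sum of the smooth function
      angle t x = PI/2 - atan (x/t) = arg (x + it).
    The midpoint Euler-Maclaurin formula of order 2k for this function produces
    t ln t - t from the primitive and exactly the k terms Im (That j (it)) from
    the derivatives at 0; the derivatives at infinity vanish.  So the imaginary
    part of Rhat (k+1) (it) is the remainder of that formula.

    Size of the remainder ([gamma_phase_limit_bound]).  Its kernel
    B_{2k}({x + 1/2}) / (2k)! is at most |B_{2k}| / (2k)! in absolute value
    ([bernoulli_poly_even_bound]), and the derivative of order 2k of the angle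
    is at most (2k-1)! / (x^2 + t^2)^k.  With x = t tan b, the integral of
    (x^2 + t^2)^(-k) over the half-line is t^(1-2k) W_{2k-2}, where W_n is the
    Wallis integral of cos^n over [0, PI/2].

    Comparison with the term.  Since |B_{2k}| = eta_k |B_{2k}(1/2)|
    ([eta_bernoulli]), dividing by Ttilde leaves eta_k (2k-1) W_{2k-2}, which is
    eta_k 2k W_{2k}.  From n W_n W_{n-1} = PI/2 and W_{2k} < W_{2k-1} one gets
    (2k W_{2k})^2 < PI k; this is where the strict inequality arises
    ([wallis_bound]).

    Identification of the branch ([Im_lnGamma_eq_phase]).  The imaginary part of
    lnGamma (1/2 + it) and the limit of the phases agree modulo 2 PI, because
    both are arguments of the same nonzero number.  Both are continuous in t and
    vanish at t = 0, hence they are equal.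

    No integral is formed anywhere: each estimate of an integral is replaced by
    a comparison of derivatives of explicit functions. *)

(** * Real derivatives *)

(* These rules speak of the operations of R instead of those of an abstract
   normed module, so that the resulting derivatives are ring expressions. *)
Lemma is_derive_Rplus (f g : R -> R) (x df dg : R) :
  is_derive f x df -> is_derive g x dg -> is_derive (fun y => f y + g y) x (df + dg).
Proof. apply @is_derive_plus. Qed.

Lemma is_derive_Rminus (f g : R -> R) (x df dg : R) :
  is_derive f x df -> is_derive g x dg -> is_derive (fun y => f y - g y) x (df - dg).
Proof. apply @is_derive_minus. Qed.

Lemma is_derive_Ropp (f : R -> R) (x df : R) :
  is_derive f x df -> is_derive (fun y => - f y) x (- df).
Proof. apply @is_derive_opp. Qed.

Lemma is_derive_Rmult (f g : R -> R) (x df dg : R) :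
  is_derive f x df -> is_derive g x dg ->
  is_derive (fun y => f y * g y) x (df * g x + f x * dg).
Proof. intros Hf Hg. apply @is_derive_mult; auto. intros; apply Rmult_comm. Qed.

Lemma is_derive_Rcomp (f g : R -> R) (x df dg : R) :
  is_derive f (g x) df -> is_derive g x dg -> is_derive (fun y => f (g y)) x (df * dg).
Proof. intros Hf Hg. rewrite Rmult_comm. now apply (is_derive_comp f g). Qed.

Lemma is_derive_Rext (f g : R -> R) (x df dg : R) :
  (forall y, f y = g y) -> df = dg -> is_derive f x df -> is_derive g x dg.
Proof. intros H <-. now apply is_derive_ext. Qed.

Lemma derive_nonneg_le (f f' : R -> R) (a b : R) : a <= b ->
  (forall x, a <= x <= b -> is_derive f x (f' x)) ->
  (forall x, a < x < b -> 0 <= f' x) -> f a <= f b.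
Proof.
  intros Hab Hd Hp. destruct (Req_dec a b) as [->|Hne]; [lra|].
  destruct (MVT_cor2 f f' a b) as [c [E Hc]]; [lra| |].
  - intros x Hx. apply is_derive_Reals. now apply Hd.
  - pose proof (Hp c Hc). nra.
Qed.

Lemma derive_pos_lt (f f' : R -> R) (a b : R) : a < b ->
  (forall x, a <= x <= b -> is_derive f x (f' x)) ->
  (forall x, a < x < b -> 0 < f' x) -> f a < f b.
Proof.
  intros Hab Hd Hp.
  destruct (MVT_cor2 f f' a b) as [c [E Hc]]; [lra| |].
  - intros x Hx. apply is_derive_Reals. now apply Hd.
  - pose proof (Hp c Hc). nra.
Qed.

Lemma derive_zero_const (f : R -> R) (a b : R) :
  (forall x, is_derive f x 0) -> f a = f b.
Proof.
  intros Hd.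
  assert (H : forall u v, u <= v -> f u = f v).
  { intros u v Huv. apply Rle_antisym.
    - apply (derive_nonneg_le f (fun _ => 0)); auto. intros; lra.
    - apply Ropp_le_cancel.
      apply (derive_nonneg_le (fun x => - f x) (fun _ => 0)); auto.
      + intros x _. replace 0 with (- 0) by ring. apply is_derive_Ropp, Hd.
      + intros; lra. }
  destruct (Rle_dec a b); [|symmetry]; apply H; lra.
Qed.

Lemma is_derive_sum_f_R0 (u : nat -> R -> R) (du : nat -> R) (n : nat) (x : R) :
  (forall i, (i <= n)%nat -> is_derive (u i) x (du i)) ->
  is_derive (fun y => sum_f_R0 (fun i => u i y) n) x (sum_f_R0 du n).
Proof.
  induction n as [|n IH]; intros H; simpl.
  - now apply H.
  - apply is_derive_Rplus; [apply IH; intros|]; apply H; lia.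
Qed.


(** * Bernoulli polynomials *)

Lemma bernoulli_poly_derive (n : nat) (u : R) :
  is_derive (bernoulli_poly (S n)) u (INR (S n) * bernoulli_poly n u).
Proof.
  unfold bernoulli_poly.
  evar_last.
  { apply (is_derive_sum_f_R0
      (fun i y => Binomial.C (S n) i * bernoulli i * y ^ (S n - i))
      (fun i => Binomial.C (S n) i * bernoulli i * (INR (S n - i) * u ^ (pred (S n - i))))).
    intros i Hi. apply is_derive_scal.
    evar_last; [apply is_derive_pow, is_derive_id|].
    unfold one, mult; simpl. ring. }
  rewrite tech5. replace (S n - S n)%nat with 0%nat by lia.
  change (INR 0) with 0. rewrite scal_sum. rewrite Rmult_0_l, Rmult_0_r, Rplus_0_r.
  apply sum_eq. intros i Hi.
  replace (pred (S n - i)) with (n - i)%nat by lia.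
  assert (E : Binomial.C (S n) i * INR (S n - i) = INR (S n) * Binomial.C n i).
  { unfold Binomial.C. replace (S n - i)%nat with (S (n - i)) by lia.
    rewrite !fact_simpl, !mult_INR.
    field. repeat split; try apply INR_fact_neq_0. apply not_0_INR; lia. }
  transitivity (Binomial.C (S n) i * INR (S n - i) * bernoulli i * u ^ (n - i)); [ring|].
  rewrite E. ring.
Qed.

Lemma bernoulli_poly_0 (u : R) : bernoulli_poly 0 u = 1.
Proof. unfold bernoulli_poly, Binomial.C, bernoulli. simpl. field. Qed.

Lemma bernoulli_poly_at_0 (n : nat) : bernoulli_poly n 0 = bernoulli n.
Proof.
  unfold bernoulli_poly. destruct n as [|n].
  - unfold Binomial.C, bernoulli; simpl; field.
  - rewrite tech5, sum_eq_R0.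
    + replace (S n - S n)%nat with 0%nat by lia. rewrite Binomial.pascal_step1 by lia.
      replace (S n - S n)%nat with 0%nat by lia.
      unfold Binomial.C. replace (S n - 0)%nat with (S n) by lia.
      change (Factorial.fact 0) with 1%nat. change (INR 1) with 1.
      simpl pow. field. apply INR_fact_neq_0.
    + intros i Hi. rewrite pow_i by lia. ring.
Qed.

Lemma bernoulli_poly_periodic (n : nat) :
  bernoulli_poly (S (S n)) 1 = bernoulli_poly (S (S n)) 0.
Proof.
  rewrite bernoulli_poly_at_0. unfold bernoulli_poly. rewrite tech5.
  rewrite (sum_eq _ (fun i => Binomial.C (S n + 1) i * bernoulli i)).
  - rewrite bernoulli_rec by lia. rewrite pow1. unfold Binomial.C.
    replace (S (S n) - S (S n))%nat with 0%nat by lia.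
    change (Factorial.fact 0) with 1%nat. change (INR 1) with 1.
    field. apply INR_fact_neq_0.
  - intros i Hi. rewrite pow1. replace (S n + 1)%nat with (S (S n)) by lia. ring.
Qed.

Lemma bernoulli_poly_1 (u : R) : bernoulli_poly 1 u = u - 1 / 2.
Proof. unfold bernoulli_poly, Binomial.C, bernoulli. simpl. unfold Binomial.C. simpl. field. Qed.

(** The two conditions p_n' = n p_{n-1} and p_n(1) = p_n(0) leave no freedom: the
    first determines p_n up to a constant, and a wrong constant in p_n would give
    p_{n+1} different values at 0 and 1.  This reduces the functional equations
    below to checking these conditions. *)
Lemma bernoulli_poly_unique (p : nat -> R -> R) :
  (forall u, p 0%nat u = 1) ->
  (forall n u, is_derive (p (S n)) u (INR (S n) * p n u)) ->
  (forall n, p (S (S n)) 1 = p (S (S n)) 0) ->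
  forall n u, p n u = bernoulli_poly n u.
Proof.
  intros H0 Hd Hper n. induction n as [|n IH]; intros u.
  { now rewrite H0, bernoulli_poly_0. }
  set (q := fun m y => p m y - bernoulli_poly m y).
  assert (Hq : forall y, q (S n) y = q (S n) 0).
  { intros y. apply derive_zero_const. intros x. unfold q.
    evar_last; [apply is_derive_Rminus; [apply Hd|apply bernoulli_poly_derive]|].
    rewrite IH. ring. }
  (* The difference in degree n + 2 is affine with slope (n + 2) q_{n+1}(0). *)
  assert (Hc : q (S (S n)) 0 - INR (S (S n)) * q (S n) 0 * 0
             = q (S (S n)) 1 - INR (S (S n)) * q (S n) 0 * 1).
  { apply (derive_zero_const (fun y => q (S (S n)) y - INR (S (S n)) * q (S n) 0 * y)).
    intros x.
    evar_last; [apply is_derive_Rminus;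
      [apply is_derive_Rminus; [apply Hd|apply bernoulli_poly_derive]
      |apply is_derive_scal, is_derive_id]|].
    specialize (Hq x). unfold q in *. unfold one; simpl. nra. }
  assert (Hn : INR (S (S n)) <> 0) by (apply not_0_INR; lia).
  unfold q in Hc at 1 3. rewrite Hper, bernoulli_poly_periodic in Hc.
  assert (E : INR (S (S n)) * q (S n) 0 = 0) by lra.
  apply Rmult_integral in E. destruct E as [E|E]; [contradiction|].
  specialize (Hq u). rewrite E in Hq. unfold q in Hq. lra.
Qed.

Lemma bernoulli_poly_symm (n : nat) (u : R) :
  bernoulli_poly n (1 - u) = (-1) ^ n * bernoulli_poly n u.
Proof.
  assert (H : (-1) ^ n * bernoulli_poly n (1 - u) = bernoulli_poly n u).
  { apply (bernoulli_poly_unique (fun m y => (-1) ^ m * bernoulli_poly m (1 - y))).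
    - intros y. rewrite bernoulli_poly_0. simpl; ring.
    - intros m y.
      evar_last.
      { apply is_derive_scal.
        apply (is_derive_Rcomp (bernoulli_poly (S m)) (fun y => 1 - y)).
        - apply bernoulli_poly_derive.
        - auto_derive; [easy|reflexivity]. }
      simpl. ring.
    - intros m. rewrite Rminus_diag, Rminus_0_r, bernoulli_poly_periodic. reflexivity. }
  rewrite <- H, <- Rmult_assoc, <- Rpow_mult_distr.
  replace (-1 * -1) with 1 by ring. rewrite pow1. ring.
Qed.

Lemma bernoulli_poly_duplication (n : nat) (u : R) :
  2 ^ n * (bernoulli_poly n (u / 2) + bernoulli_poly n (u / 2 + 1 / 2))
  = 2 * bernoulli_poly n u.
Proof.
  assert (H : / 2 * 2 ^ n * (bernoulli_poly n (u / 2) + bernoulli_poly n (u / 2 + 1 / 2))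
              = bernoulli_poly n u); [|lra].
  apply (bernoulli_poly_unique (fun m y =>
    / 2 * 2 ^ m * (bernoulli_poly m (y / 2) + bernoulli_poly m (y / 2 + 1 / 2)))).
  - intros y. rewrite !bernoulli_poly_0. simpl; field.
  - intros m y.
    evar_last.
    { apply is_derive_scal. apply is_derive_Rplus.
      - apply (is_derive_Rcomp (bernoulli_poly (S m)) (fun y => y / 2)).
        + apply bernoulli_poly_derive.
        + auto_derive; [easy|reflexivity].
      - apply (is_derive_Rcomp (bernoulli_poly (S m)) (fun y => y / 2 + 1 / 2)).
        + apply bernoulli_poly_derive.
        + auto_derive; [easy|reflexivity]. }
    simpl. field.
  - intros m. replace (1 / 2 + 1 / 2) with 1 by field.
    replace (0 / 2 + 1 / 2) with (1 / 2) by field. replace (0 / 2) with 0 by field.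
    rewrite bernoulli_poly_periodic. ring.
Qed.

Lemma bernoulli_poly_odd_half (n : nat) : Nat.Odd n -> bernoulli_poly n (1 / 2) = 0.
Proof.
  intros [m ->]. pose proof (bernoulli_poly_symm (2 * m + 1) (1 / 2)) as H.
  rewrite Nat.add_1_r, pow_1_odd in H. replace (1 - 1 / 2) with (1 / 2) in H by field.
  rewrite Nat.add_1_r. lra.
Qed.

Lemma bernoulli_odd (k : nat) : (1 <= k)%nat -> bernoulli_poly (S (2 * k)) 0 = 0.
Proof.
  intros Hk. pose proof (bernoulli_poly_symm (S (2 * k)) 0) as H.
  rewrite pow_1_odd, Rminus_0_r in H.
  destruct k as [|k]; [lia|].
  replace (2 * S k)%nat with (S (2 * k + 1)) in * by lia.
  rewrite bernoulli_poly_periodic in H. lra.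
Qed.

Lemma bernoulli_poly_half (n : nat) :
  bernoulli_poly n (1 / 2) = - (1 - 2 / 2 ^ n) * bernoulli n.
Proof.
  pose proof (bernoulli_poly_duplication n 0) as H.
  replace (0 / 2 + 1 / 2) with (1 / 2) in H by field. replace (0 / 2) with 0 in H by field.
  rewrite bernoulli_poly_at_0 in H.
  assert (Hp : 2 ^ n <> 0) by (apply pow_nonzero; lra).
  apply Rmult_eq_reg_l with (2 ^ n); [|exact Hp].
  transitivity (2 * bernoulli n - 2 ^ n * bernoulli n); [lra|]. field. exact Hp.
Qed.

(** A joint induction.  On (0, 1/2) the sign of B_{2k+1} makes
    (-1)^(k+1) B_{2k+2} strictly increasing; then (-1)^k B_{2k+3}, whose derivative
    is a negative multiple of it, is strictly concave and vanishes at both ends of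
    [0, 1/2], so it is positive inside. *)
Lemma bernoulli_poly_sign (k : nat) :
  (forall u, 0 < u < 1 / 2 -> 0 < (-1) ^ S k * bernoulli_poly (S (2 * k)) u) /\
  (forall u v, 0 <= u < v -> v <= 1 / 2 ->
     (-1) ^ S k * bernoulli_poly (2 * S k) u < (-1) ^ S k * bernoulli_poly (2 * S k) v).
Proof.
  assert (Step : forall k,
    (forall u, 0 < u < 1 / 2 -> 0 < (-1) ^ S k * bernoulli_poly (S (2 * k)) u) ->
    forall u v, 0 <= u < v -> v <= 1 / 2 ->
    (-1) ^ S k * bernoulli_poly (2 * S k) u < (-1) ^ S k * bernoulli_poly (2 * S k) v).
  { clear k. intros k H u v Huv Hv.
    apply (derive_pos_lt (fun y => (-1) ^ S k * bernoulli_poly (2 * S k) y)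
      (fun y => (-1) ^ S k * (INR (S (S (2 * k))) * bernoulli_poly (S (2 * k)) y))); [lra| |].
    - intros x _. apply is_derive_scal.
      replace (2 * S k)%nat with (S (S (2 * k))) by lia. apply bernoulli_poly_derive.
    - intros x Hx.
      replace (_ * _) with
        (INR (S (S (2 * k))) * ((-1) ^ S k * bernoulli_poly (S (2 * k)) x)) by ring.
      apply Rmult_lt_0_compat; [apply lt_0_INR; lia|]. apply H. lra. }
  induction k as [|k [_ IH]].
  - assert (H0 : forall u, 0 < u < 1 / 2 -> 0 < (-1) ^ 1 * bernoulli_poly (S (2 * 0)) u).
    { intros u Hu. change (S (2 * 0)) with 1%nat. rewrite bernoulli_poly_1. simpl. lra. }
    split; [exact H0|]. now apply Step.
  - assert (H1 : forall u, 0 < u < 1 / 2 ->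
      0 < (-1) ^ S (S k) * bernoulli_poly (S (2 * S k)) u).
    { intros u Hu.
      set (g := fun y => (-1) ^ S (S k) * bernoulli_poly (S (2 * S k)) y).
      set (h := fun y => (-1) ^ S k * bernoulli_poly (2 * S k) y).
      set (c := INR (S (2 * S k))).
      assert (Hg : forall y, is_derive g y (- c * h y)).
      { intros y. unfold g, h. evar_last; [apply is_derive_scal, bernoulli_poly_derive|].
        unfold c. simpl pow. ring. }
      assert (Hc : 0 < c) by (apply lt_0_INR; lia).
      assert (E0 : g 0 = 0) by (unfold g; rewrite bernoulli_odd by lia; ring).
      assert (E1 : g (1 / 2) = 0).
      { unfold g. rewrite bernoulli_poly_odd_half; [ring|]. exists (S k). lia. }
      (* If g u <= 0, the mean values below give h a >= 0 >= h b with a < b. *)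
      destruct (MVT_cor2 g (fun y => - c * h y) 0 u) as [a [Ea Ha]]; [lra| |].
      { intros; apply is_derive_Reals, Hg. }
      destruct (MVT_cor2 g (fun y => - c * h y) u (1 / 2)) as [b [Eb Hb]]; [lra| |].
      { intros; apply is_derive_Reals, Hg. }
      assert (Hab : h a < h b) by (apply IH; lra).
      rewrite E0 in Ea. rewrite E1 in Eb. fold (g u).
      clearbody g h c.
      assert (P1 : g u = c * - h a * u) by lra.
      assert (P2 : g u = c * h b * (1 / 2 - u)) by lra.
      destruct (Rlt_dec 0 (g u)) as [|N]; [assumption|exfalso].
      assert (0 <= h a) by (destruct (Rle_dec 0 (h a)); [assumption|exfalso];
        assert (0 < c * - h a * u) by (repeat apply Rmult_lt_0_compat; lra); lra).
      assert (0 < c * h b * (1 / 2 - u)) by (repeat apply Rmult_lt_0_compat; lra). lra. }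
    split; [exact H1|]. now apply Step.
Qed.

Lemma two_pow_bound (k : nat) : (1 <= k)%nat -> 0 < 2 / 2 ^ (2 * k) <= 1 / 2.
Proof.
  intros Hk. assert (Hp : 4 <= 2 ^ (2 * k)).
  { replace 4 with (2 ^ 2) by ring. apply Rle_pow; [lra|lia]. }
  split; [apply Rdiv_lt_0_compat; lra|]. apply Rle_div_l; lra.
Qed.

(** The value at 1/2 is the one at 0 times a factor between -1 and 0, while
    (-1)^k B_{2k} increases from 0 to 1/2: so it starts negative. *)
Lemma bernoulli_even_sign (k : nat) : (1 <= k)%nat -> (-1) ^ k * bernoulli (2 * k) < 0.
Proof.
  intros Hk. destruct k as [|k]; [lia|].
  pose proof (proj2 (bernoulli_poly_sign k) 0 (1 / 2)) as H.
  rewrite bernoulli_poly_at_0, bernoulli_poly_half in H.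
  pose proof (two_pow_bound (S k) Hk). specialize (H ltac:(lra) ltac:(lra)).
  set (e := 2 / 2 ^ (2 * S k)) in *. set (v := (-1) ^ S k * bernoulli (2 * S k)) in *.
  assert (v < - (1 - e) * v) by (unfold v at 2; lra). nra.
Qed.

(** By monotonicity on [0, 1/2] the extreme values are those at 0 and 1/2, and the
    one at 1/2 is the smaller in absolute value by [bernoulli_poly_half]. *)
Lemma bernoulli_poly_even_bound (k : nat) (u : R) : (1 <= k)%nat -> 0 <= u <= 1 ->
  Rabs (bernoulli_poly (2 * k) u) <= Rabs (bernoulli (2 * k)).
Proof.
  intros Hk.
  assert (Half : forall u, 0 <= u <= 1 / 2 ->
    Rabs (bernoulli_poly (2 * k) u) <= Rabs (bernoulli (2 * k))).
  { clear u. intros u Hu. pose proof (bernoulli_even_sign k Hk) as Hs.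
    pose proof (two_pow_bound k Hk) as He. destruct k as [|k]; [lia|].
    pose proof (proj2 (bernoulli_poly_sign k)) as Hmon.
    assert (A : forall x, Rabs x = Rabs ((-1) ^ S k * x)).
    { intros x. now rewrite Rabs_mult, pow_1_abs, Rmult_1_l. }
    rewrite (A (bernoulli_poly _ _)), (A (bernoulli _)).
    set (h := fun y => (-1) ^ S k * bernoulli_poly (2 * S k) y) in *.
    assert (L : h 0 <= h u).
    { destruct (Req_dec u 0) as [->|]; [lra|]. left; apply Hmon; lra. }
    assert (U : h u <= h (1 / 2)).
    { destruct (Req_dec u (1 / 2)) as [->|]; [lra|]. left; apply Hmon; lra. }
    assert (E0 : h 0 = (-1) ^ S k * bernoulli (2 * S k)).
    { unfold h. now rewrite bernoulli_poly_at_0. }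
    assert (E1 : h (1 / 2) = - (1 - 2 / 2 ^ (2 * S k)) * h 0).
    { rewrite E0. unfold h. rewrite bernoulli_poly_half. ring. }
    fold (h u). rewrite <- E0 in *. rewrite (Rabs_left (h 0)) by lra.
    apply Rabs_le. nra. }
  intros Hu. destruct (Rle_dec u (1 / 2)); [apply Half; lra|].
  rewrite <- (Rmult_1_l (bernoulli_poly _ _)), <- (pow_1_even k), <- bernoulli_poly_symm.
  apply Half; lra.
Qed.

Lemma eta_bernoulli (k : nat) : (1 <= k)%nat ->
  eta k * Rabs (bernoulli_poly (2 * k) (1 / 2)) = Rabs (bernoulli (2 * k)).
Proof.
  intros Hk. pose proof (two_pow_bound k Hk) as He.
  unfold eta. replace (powerRZ 2 (1 - 2 * Z.of_nat k)) with (2 / 2 ^ (2 * k)).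
  - rewrite bernoulli_poly_half, Rabs_mult, Rabs_Ropp, (Rabs_pos_eq (1 - _)) by lra.
    rewrite <- Rmult_assoc, Rinv_l, Rmult_1_l by lra. reflexivity.
  - unfold Zminus. rewrite powerRZ_add by lra. rewrite powerRZ_1.
    replace (- (2 * Z.of_nat k))%Z with (- Z.of_nat (2 * k))%Z by lia.
    rewrite powerRZ_neg', <- pow_powerRZ. reflexivity.
Qed.

Lemma bernoulli_half_abs (k : nat) : (1 <= k)%nat ->
  Rabs (bernoulli_poly (2 * k) (1 / 2)) = (-1) ^ k * bernoulli_poly (2 * k) (1 / 2)
  /\ 0 < Rabs (bernoulli_poly (2 * k) (1 / 2)).
Proof.
  intros Hk. pose proof (bernoulli_even_sign k Hk) as Hs. pose proof (two_pow_bound k Hk) as He.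
  assert (P : 0 < (-1) ^ k * bernoulli_poly (2 * k) (1 / 2)).
  { rewrite bernoulli_poly_half. nra. }
  assert (E : Rabs (bernoulli_poly (2 * k) (1 / 2)) = (-1) ^ k * bernoulli_poly (2 * k) (1 / 2)).
  { rewrite <- (Rabs_pos_eq ((-1) ^ k * _)) by lra.
    rewrite Rabs_mult, pow_1_abs. ring. }
  split; lra.
Qed.

(** * The midpoint Euler-Maclaurin formula *)

(** The boundary terms left by integrating f 0 by parts m + 1 times against the
    Bernoulli polynomials translated by s; here f i stands for the i-th derivative of f 0. *)
Definition em_boundary (f : nat -> R -> R) (m : nat) (s x : R) : R :=
  sum_f_R0 (fun i => (-1) ^ i * bernoulli_poly (S i) (x - s) / INR (fact (S i)) * f i x) m.

(** The sum telescopes because B_{i+1}' = (i+1) B_i. *)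
Lemma em_boundary_derive (f : nat -> R -> R) (m : nat) (s x : R) :
  (forall n (y : R), is_derive (f n) y (f (S n) y)) ->
  is_derive (em_boundary f m s) x
    (f 0%nat x + (-1) ^ m * bernoulli_poly (S m) (x - s) / INR (fact (S m)) * f (S m) x).
Proof.
  intros Hf.
  assert (Term : forall i, is_derive
    (fun y => (-1) ^ i * bernoulli_poly (S i) (y - s) / INR (fact (S i)) * f i y) x
    ((-1) ^ i * bernoulli_poly i (x - s) / INR (fact i) * f i x
     + (-1) ^ i * bernoulli_poly (S i) (x - s) / INR (fact (S i)) * f (S i) x)).
  { intros i.
    apply (is_derive_Rext
      (fun y => (-1) ^ i / INR (fact (S i)) * (bernoulli_poly (S i) (y - s) * f i y)) _ _
      ((-1) ^ i / INR (fact (S i)) * (INR (S i) * bernoulli_poly i (x - s) * 1 * f i x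
         + bernoulli_poly (S i) (x - s) * f (S i) x))).
    { intros; unfold Rdiv; ring. }
    2: { apply is_derive_scal.
      apply (is_derive_Rmult (fun y => bernoulli_poly (S i) (y - s)) (f i)); [|apply Hf].
      apply (is_derive_Rcomp (bernoulli_poly (S i)) (fun y => y - s)); [apply bernoulli_poly_derive|].
      auto_derive; [easy|ring]. }
    rewrite fact_simpl, mult_INR. field. split; [apply INR_fact_neq_0|apply not_0_INR; lia]. }
  induction m as [|m IH].
  - evar_last; [apply (Term 0%nat)|]. rewrite bernoulli_poly_0. simpl. field.
  - evar_last; [apply is_derive_Rplus; [apply IH|apply (Term (S m))]|].
    simpl pow. field.
    split; apply INR_fact_neq_0.
Qed.

(** B_{i+1}(1) = B_{i+1}(0) except for i = 0, where the difference is 1: at each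
    midpoint, passing to the next translate picks up just the value of f 0. *)
Lemma em_boundary_jump (f : nat -> R -> R) (m : nat) (x : R) :
  em_boundary f m (x - 1) x - em_boundary f m x x = f 0%nat x.
Proof.
  unfold em_boundary. replace (x - (x - 1)) with 1 by ring. replace (x - x) with 0 by ring.
  induction m as [|m IH].
  - simpl. rewrite !bernoulli_poly_1. field.
  - rewrite !tech5. rewrite bernoulli_poly_periodic. lra.
Qed.

(** The odd Bernoulli polynomials vanish at 1/2. *)
Lemma em_boundary_half (f : nat -> R -> R) (k : nat) (x : R) :
  em_boundary f (S (2 * k)) (x - 1 / 2) x
  = - sum_n_m (fun j => bernoulli_poly (2 * j) (1 / 2) / INR (fact (2 * j)) * f (2 * j - 1)%nat x)
      1 (S k).
Proof.
  unfold em_boundary. replace (x - (x - 1 / 2)) with (1 / 2) by ring.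
  assert (Odd : forall j, bernoulli_poly (S (2 * j)) (1 / 2) = 0).
  { intros j. apply bernoulli_poly_odd_half. exists j; lia. }
  induction k as [|k IH].
  - rewrite sum_n_n. rewrite tech5. change (sum_f_R0 _ (2 * 0)) with
      ((-1) ^ 0 * bernoulli_poly (S (2 * 0)) (1 / 2) / INR (fact 1) * f 0%nat x).
    rewrite Odd. replace (2 * 1)%nat with 2%nat by lia. replace (2 * 0)%nat with 0%nat by lia.
    simpl. field.
  - rewrite sum_n_Sm by lia. replace (2 * S k)%nat with (S (S (2 * k))) at 1 by lia.
    rewrite 2!tech5, IH. replace (S (S (2 * k))) with (2 * S k)%nat by lia.
    rewrite Odd, pow_1_odd. replace (2 * S (S k))%nat with (S (S (2 * S k))) by lia.
    replace (S (S (2 * S k)) - 1)%nat with (S (2 * S k)) by lia.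
    change (@plus R_AbelianMonoid) with Rplus.
    set (w := sum_n_m _ _ _). unfold Rdiv. ring.
Qed.

(** A and G are primitives of the summand and of a majorant of its derivative of
    order 2k; using them instead of integrals, the remainder estimate follows from
    monotonicity of em_boundary - A - cG and em_boundary - A + cG on each half cell. *)
Theorem midpoint_euler_maclaurin (f : nat -> R -> R) (A G g : R -> R) (k N : nat) :
  (1 <= k)%nat ->
  (forall n (x : R), is_derive (f n) x (f (S n) x)) ->
  (forall x, is_derive A x (f 0%nat x)) ->
  (forall x, is_derive G x (g x)) ->
  (forall x, Rabs (f (2 * k)%nat x) <= g x) ->
  Rabs (sum_f_R0 (fun m => f 0%nat (INR m + 1 / 2)) N
        - (A (INR (S N)) - A 0)
        - (sum_n_m (fun j => bernoulli_poly (2 * j) (1 / 2) / INR (fact (2 * j))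
              * f (2 * j - 1)%nat (INR (S N))) 1 k
           - sum_n_m (fun j => bernoulli_poly (2 * j) (1 / 2) / INR (fact (2 * j))
              * f (2 * j - 1)%nat 0) 1 k))
  <= Rabs (bernoulli (2 * k)) / INR (fact (2 * k)) * (G (INR (S N)) - G 0).
Proof.
  intros Hk Hf HA HG Hg. set (c := Rabs (bernoulli (2 * k)) / INR (fact (2 * k))).
  destruct k as [|k]; [lia|]. clear Hk. set (m := S (2 * k)).
  assert (Piece : forall s a b, s <= a -> a <= b -> b <= s + 1 ->
    Rabs (em_boundary f m s b - em_boundary f m s a - (A b - A a)) <= c * (G b - G a)).
  { intros s a b Ha Hab Hb.
    assert (E : forall x, s <= x <= s + 1 ->
      Rabs ((-1) ^ m * bernoulli_poly (S m) (x - s) / INR (fact (S m)) * f (S m) x) <= c * g x).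
    { intros x Hx. unfold c, Rdiv.
      rewrite !Rabs_mult, pow_1_abs, Rmult_1_l.
      pose proof (Rinv_0_lt_compat _ (INR_fact_lt_0 (S m))).
      rewrite (Rabs_pos_eq (/ _)) by lra.
      replace (S m) with (2 * S k)%nat in * by (unfold m; lia).
      apply Rmult_le_compat; [|apply Rabs_pos| |apply Hg].
      - apply Rmult_le_pos; [apply Rabs_pos|lra].
      - apply Rmult_le_compat_r; [lra|]. apply bernoulli_poly_even_bound; [lia|lra]. }
    apply Rabs_le. split.
    - assert (H : em_boundary f m s a - A a + c * G a <= em_boundary f m s b - A b + c * G b); [|lra].
      apply (derive_nonneg_le (fun x => em_boundary f m s x - A x + c * G x)
        (fun x => ((f 0%nat x + (-1) ^ m * bernoulli_poly (S m) (x - s) / INR (fact (S m)) * f (S m) x)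
           - f 0%nat x) + c * g x)); [lra| |].
      + intros x Hx. apply is_derive_Rplus; [apply is_derive_Rminus|apply is_derive_scal]; auto.
        now apply em_boundary_derive.
      + intros x Hx. specialize (E x). apply Rabs_le_between in E; lra.
    - assert (H : - (em_boundary f m s a - A a) + c * G a <= - (em_boundary f m s b - A b) + c * G b); [|lra].
      apply (derive_nonneg_le (fun x => - (em_boundary f m s x - A x) + c * G x)
        (fun x => - ((f 0%nat x + (-1) ^ m * bernoulli_poly (S m) (x - s) / INR (fact (S m)) * f (S m) x)
           - f 0%nat x) + c * g x)); [lra| |].
      + intros x Hx. apply is_derive_Rplus;
          [apply is_derive_Ropp, is_derive_Rminus|apply is_derive_scal]; auto.
        now apply em_boundary_derive.
      + intros x Hx. specialize (E x). apply Rabs_le_between in E; lra. }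
  assert (Cell : forall n,
    Rabs (f 0%nat (INR n + 1 / 2) - (A (INR (S n)) - A (INR n))
      + (em_boundary f m (INR (S n) - 1 / 2) (INR (S n)) - em_boundary f m (INR n - 1 / 2) (INR n)))
    <= c * (G (INR (S n)) - G (INR n))).
  { intros n. rewrite S_INR. set (x := INR n).
    pose proof (Piece (x - 1 / 2) x (x + 1 / 2) ltac:(lra) ltac:(lra) ltac:(lra)) as P1.
    pose proof (Piece (x + 1 / 2) (x + 1 / 2) (x + 1) ltac:(lra) ltac:(lra) ltac:(lra)) as P2.
    pose proof (em_boundary_jump f m (x + 1 / 2)) as J.
    replace (x + 1 / 2 - 1) with (x - 1 / 2) in J by lra.
    replace (x + 1 - 1 / 2) with (x + 1 / 2) by lra.
    apply Rabs_le_between in P1. apply Rabs_le_between in P2. apply Rabs_le. lra. }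
  assert (Sum : Rabs (sum_f_R0 (fun m => f 0%nat (INR m + 1 / 2)) N - (A (INR (S N)) - A 0)
      + (em_boundary f m (INR (S N) - 1 / 2) (INR (S N)) - em_boundary f m (0 - 1 / 2) 0))
    <= c * (G (INR (S N)) - G 0)).
  { induction N as [|N IH].
    - apply (Cell 0%nat).
    - rewrite tech5. specialize (Cell (S N)).
      apply Rabs_le_between in Cell. apply Rabs_le_between in IH. apply Rabs_le. lra. }
  unfold m in Sum. rewrite !em_boundary_half in Sum. clearbody c.
  match goal with |- Rabs ?u <= _ => match type of Sum with Rabs ?v <= _ =>
    replace u with v by ring end end. exact Sum.
Qed.

(** * Wallis integrals *)

(** The reduction formula for the integral of cos^n from 0 to x. *)
Fixpoint cos_pow_primitive (n : nat) (x : R) : R :=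
  match n with
  | O => x
  | S O => sin x
  | S (S m as l) => (cos x ^ l * sin x + INR l * cos_pow_primitive m x) / INR n
  end.

Lemma cos_pow_primitive_derive (n : nat) (x : R) :
  is_derive (cos_pow_primitive n) x (cos x ^ n).
Proof.
  enough (H : is_derive (cos_pow_primitive n) x (cos x ^ n)
    /\ is_derive (cos_pow_primitive (S n)) x (cos x ^ S n)) by apply H.
  induction n as [|n [IH1 IH2]]; split; auto.
  - apply @is_derive_id.
  - rewrite pow_1. apply (is_derive_ext sin); [reflexivity|]. apply is_derive_sin.
  - apply (is_derive_Rext (fun y => / INR (S (S n)) *
      (cos y ^ S n * sin y + INR (S n) * cos_pow_primitive n y)) _ _
      (/ INR (S (S n)) * (INR (S n) * - sin x * cos x ^ n * sin x + cos x ^ S n * cos x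
        + INR (S n) * cos x ^ n))).
    { intros y. change (cos_pow_primitive (S (S n)) y) with
       ((cos y ^ S n * sin y + INR (S n) * cos_pow_primitive n y) / INR (S (S n))).
      unfold Rdiv; ring. }
    2: { apply is_derive_scal, is_derive_Rplus; [|apply is_derive_scal, IH1].
      apply is_derive_Rmult; [apply (is_derive_pow cos (S n)), is_derive_cos|apply is_derive_sin]. }
    assert (Hn : INR (S (S n)) <> 0) by (apply not_0_INR; lia).
    apply Rmult_eq_reg_l with (INR (S (S n))); [|exact Hn].
    rewrite <- Rmult_assoc, Rinv_r, Rmult_1_l by exact Hn.
    rewrite (S_INR (S n)). simpl pow.
    pose proof (sin2_cos2 x) as T. unfold Rsqr in T.
    replace (INR (S n) * - sin x * cos x ^ n * sin x) with
      (- INR (S n) * cos x ^ n * (sin x * sin x)) by ring.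
    replace (sin x * sin x) with (1 - cos x * cos x) by lra. ring.
Qed.

Lemma cos_pow_primitive_0 (n : nat) : cos_pow_primitive n 0 = 0.
Proof.
  enough (H : cos_pow_primitive n 0 = 0 /\ cos_pow_primitive (S n) 0 = 0) by apply H.
  induction n as [|n [IH1 IH2]]; split; auto.
  - apply sin_0.
  - change (cos_pow_primitive (S (S n)) 0) with
       ((cos 0 ^ S n * sin 0 + INR (S n) * cos_pow_primitive n 0) / INR (S (S n))).
    rewrite IH1, sin_0. unfold Rdiv; ring.
Qed.

Definition wallis (n : nat) : R := cos_pow_primitive n (PI / 2).

Lemma wallis_step (n : nat) : INR (S (S n)) * wallis (S (S n)) = INR (S n) * wallis n.
Proof.
  unfold wallis. change (cos_pow_primitive (S (S n)) (PI / 2)) with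
       ((cos (PI / 2) ^ S n * sin (PI / 2) + INR (S n) * cos_pow_primitive n (PI / 2))
         / INR (S (S n))).
  rewrite cos_PI2, pow_i by lia. field. apply not_0_INR; lia.
Qed.

Lemma wallis_product (n : nat) : INR (S n) * wallis n * wallis (S n) = PI / 2.
Proof.
  induction n as [|n IH].
  - unfold wallis. simpl. rewrite sin_PI2. ring.
  - transitivity (wallis (S n) * (INR (S (S n)) * wallis (S (S n)))); [ring|].
    rewrite wallis_step, <- IH. ring.
Qed.

Lemma wallis_pos (n : nat) : 0 < wallis n.
Proof.
  pose proof PI_RGT_0. rewrite <- (cos_pow_primitive_0 n).
  apply (derive_pos_lt (cos_pow_primitive n) (fun x => cos x ^ n)); [lra| |].
  - intros x _. apply cos_pow_primitive_derive.
  - intros x Hx. apply pow_lt, cos_gt_0; lra.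
Qed.

Lemma wallis_decreasing (n : nat) : wallis (S n) < wallis n.
Proof.
  pose proof PI_RGT_0 as Hpi.
  assert (H : cos_pow_primitive n 0 - cos_pow_primitive (S n) 0 < wallis n - wallis (S n)).
  { apply (derive_pos_lt (fun x => cos_pow_primitive n x - cos_pow_primitive (S n) x)
      (fun x => cos x ^ n - cos x ^ S n)); [lra| |].
    - intros x _. apply is_derive_Rminus; apply cos_pow_primitive_derive.
    - intros x Hx. pose proof (cos_gt_0 x ltac:(lra) ltac:(lra)) as Hc.
      pose proof (pow_lt _ n Hc).
      assert (cos x < 1) by (rewrite <- cos_0; apply cos_decreasing_1; lra).
      simpl pow. nra. }
  rewrite !cos_pow_primitive_0 in H. lra.
Qed.

(** With b = W_{2k+2} and c = W_{2k+1} one has b < c and (2k+2) b c = PI/2; hence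
    ((2k+2) b)^2 < (2k+2)^2 b c = PI (k+1). *)
Lemma wallis_bound (k : nat) : INR (S (2 * k)) * wallis (2 * k) < sqrt (PI * INR (S k)).
Proof.
  rewrite <- wallis_step.
  pose proof (wallis_product (S (2 * k))) as P. pose proof (wallis_decreasing (S (2 * k))) as D.
  pose proof (wallis_pos (S (S (2 * k)))) as Q.
  assert (E : INR (S (S (2 * k))) = 2 * INR (S k)).
  { replace (S (S (2 * k))) with (2 * S k)%nat by lia. rewrite mult_INR. reflexivity. }
  rewrite E in *. assert (Hk : 0 < INR (S k)) by (apply lt_0_INR; lia).
  set (b := wallis (S (S (2 * k)))) in *. set (c := wallis (S (2 * k))) in *.
  set (K := INR (S k)) in *. clearbody b c K.
  rewrite <- (sqrt_Rsqr (2 * K * b)).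
  2: { repeat apply Rmult_le_pos; lra. }
  apply sqrt_lt_1_alt. split; [apply Rle_0_sqr|].
  replace (PI * K) with (2 * K * (PI / 2)) by field. rewrite <- P. unfold Rsqr.
  replace (2 * K * b * (2 * K * b)) with (4 * K * K * b * b) by ring.
  replace (2 * K * (2 * K * c * b)) with (4 * K * K * b * c) by ring.
  apply Rmult_lt_compat_l; [|exact D]. repeat apply Rmult_lt_0_compat; lra.
Qed.

Lemma cos_pow_primitive_le_wallis (k : nat) (x : R) : - (PI / 2) <= x <= PI / 2 ->
  cos_pow_primitive k x <= wallis k.
Proof.
  intros Hx. apply (derive_nonneg_le (cos_pow_primitive k) (fun x => cos x ^ k)); [lra| |].
  - intros; apply cos_pow_primitive_derive.
  - intros; apply pow_le, cos_ge_0; lra.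
Qed.

(** * The angle of x + it and its derivatives in x *)

(** The argument of x + it for t > 0.  Written with atan (x/t) rather than
    atan (t/x), it is smooth across x = 0. *)
Definition angle (t x : R) : R := PI / 2 - atan (x / t).

Lemma sin_angle (t x : R) : sin (angle t x) = cos (atan (x / t)).
Proof. apply sin_shift. Qed.

Lemma cos_atan_sqr (y : R) : cos (atan y) ^ 2 = / (1 + y ^ 2).
Proof.
  assert (0 < 1 + y ^ 2) by (pose proof (pow2_ge_0 y); lra).
  rewrite cos_atan. unfold Rdiv. rewrite Rmult_1_l, pow_inv, <- Rsqr_pow2, Rsqr_sqrt.
  - now rewrite Rsqr_pow2.
  - rewrite Rsqr_pow2; lra.
Qed.

Lemma atan_scaled_derive (t x : R) : 0 < t ->
  is_derive (fun y => atan (y / t)) x (cos (atan (x / t)) ^ 2 / t).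
Proof.
  intros Ht. rewrite cos_atan_sqr.
  apply (is_derive_Rext (fun y => atan (y / t)) _ _ (/ (1 + (x / t)²) * / t)).
  - reflexivity.
  - rewrite Rsqr_pow2. reflexivity.
  - apply (is_derive_Rcomp atan (fun y => y / t)); [apply is_derive_atan|].
    auto_derive; [easy|ring].
Qed.

Lemma angle_derive (t x : R) : 0 < t ->
  is_derive (angle t) x (- (sin (angle t x) ^ 2 / t)).
Proof.
  intros Ht. rewrite sin_angle.
  apply (is_derive_Rext (fun y => PI / 2 - atan (y / t)) _ _ (0 - cos (atan (x / t)) ^ 2 / t));
    [reflexivity|ring|].
  apply is_derive_Rminus; [apply @is_derive_const|now apply atan_scaled_derive].
Qed.

(** The n-th derivative of Im log (x + it) is, for n > 0,
    (-1)^(n-1) (n-1)! Im (x + it)^(-n).  As |x + it| = t / sin a with a the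
    argument, it is a trigonometric expression in a. *)
Definition angle_deriv (t : R) (n : nat) (x : R) : R :=
  match n with
  | O => angle t x
  | S m => (-1) ^ n * INR (fact m) / t ^ n * (sin (angle t x) ^ n * sin (INR n * angle t x))
  end.

(** In terms of the argument a, differentiating sin^n a sin (n a) gives
    n sin^(n-1) a sin ((n+1) a), and the argument itself has derivative
    - sin^2 a / t in x. *)
Lemma angle_deriv_derive (t x : R) (n : nat) : 0 < t ->
  is_derive (angle_deriv t n) x (angle_deriv t (S n) x).
Proof.
  intros Ht. destruct n as [|m].
  - apply (is_derive_Rext (angle t) _ _ (- (sin (angle t x) ^ 2 / t)));
      [reflexivity| |now apply angle_derive].
    simpl. rewrite Rmult_1_l. field. lra.
  - set (c := (-1) ^ S m * INR (fact m) / t ^ S m). set (a := angle t x).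
    apply (is_derive_Rext
      (fun y => c * (sin (angle t y) ^ S m * sin (INR (S m) * angle t y))) _ _
      (c * ((INR (S m) * cos a * sin a ^ m * sin (INR (S m) * a)
             + sin a ^ S m * (cos (INR (S m) * a) * (INR (S m) * 1)))
            * - (sin a ^ 2 / t)))); [reflexivity| |].
    + unfold angle_deriv. fold a. unfold c.
      replace (INR (S (S m)) * a) with (INR (S m) * a + a) by (rewrite (S_INR (S m)); ring).
      rewrite sin_plus, fact_simpl, mult_INR. simpl pow. field.
      split; [apply pow_nonzero|]; lra.
    + apply is_derive_scal.
      apply (is_derive_Rcomp (fun b => sin b ^ S m * sin (INR (S m) * b)) (angle t));
        [|now apply angle_derive].
      fold a. apply (is_derive_Rmult (fun b => sin b ^ S m) (fun b => sin (INR (S m) * b))).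
      * apply (is_derive_pow sin (S m)), is_derive_sin.
      * apply (is_derive_Rcomp sin (fun b => INR (S m) * b)); [apply is_derive_sin|].
        apply is_derive_scal, @is_derive_id.
Qed.

(** Up to the term -t this is Im (z log z - z) at z = x + it. *)
Definition angle_primitive (t x : R) : R := x * angle t x + t / 2 * ln (x ^ 2 + t ^ 2).

Lemma angle_primitive_derive (t x : R) : 0 < t ->
  is_derive (angle_primitive t) x (angle t x).
Proof.
  intros Ht.
  assert (Hp : 0 < x ^ 2 + t ^ 2) by (pose proof (pow2_ge_0 x); pose proof (pow_lt t 2 Ht); lra).
  apply (is_derive_Rext (fun y => y * angle t y + t / 2 * ln (y ^ 2 + t ^ 2)) _ _
    (1 * angle t x + x * - (sin (angle t x) ^ 2 / t) + t / 2 * (/ (x ^ 2 + t ^ 2) * (2 * x))));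
    [reflexivity| |].
  - rewrite sin_angle, cos_atan_sqr. field. repeat split; nra.
  - apply is_derive_Rplus; [apply is_derive_Rmult; [apply @is_derive_id|now apply angle_derive]|].
    apply is_derive_scal. apply (is_derive_Rcomp ln (fun y => y ^ 2 + t ^ 2)).
    + now apply is_derive_ln.
    + auto_derive; [easy|ring].
Qed.

Lemma sin_odd_half_PI (l : nat) : sin (INR (S (2 * l)) * (PI / 2)) = (-1) ^ l.
Proof.
  induction l as [|l IH].
  - simpl. rewrite Rmult_1_l. apply sin_PI2.
  - replace (INR (S (2 * S l)) * (PI / 2)) with (INR (S (2 * l)) * (PI / 2) + PI).
    + rewrite neg_sin, IH. simpl; ring.
    + replace (S (2 * S l)) with (S (2 * l) + 2)%nat by lia. rewrite plus_INR. simpl (INR 2). field.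
Qed.

Lemma angle_deriv_at_0 (t : R) (j : nat) : 0 < t -> (1 <= j)%nat ->
  angle_deriv t (2 * j - 1) 0 = (-1) ^ j * INR (fact (2 * j - 2)) / t ^ (2 * j - 1).
Proof.
  intros Ht Hj. destruct j as [|l]; [lia|].
  replace (2 * S l - 1)%nat with (S (2 * l)) by lia.
  replace (2 * S l - 2)%nat with (2 * l)%nat by lia.
  unfold angle_deriv. replace (angle t 0) with (PI / 2).
  - rewrite sin_PI2, pow1, sin_odd_half_PI, pow_1_odd. simpl pow. field.
    split; [apply pow_nonzero|]; lra.
  - unfold angle. replace (0 / t) with 0 by (field; lra). rewrite atan_0. ring.
Qed.

Lemma atan_bounds (y : R) : 0 <= y -> y / (1 + y ^ 2) <= atan y <= y.
Proof.
  intros Hy. destruct (Req_dec y 0) as [->|Hne]; [rewrite atan_0; split; lra|].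
  destruct (MVT_cor2 atan (fun c => / (1 + c ^ 2)) 0 y) as [c [E Hc]]; [lra| |].
  - intros; apply derivable_pt_lim_atan.
  - rewrite atan_0, !Rminus_0_r in E. rewrite E.
    assert (0 <= c ^ 2 <= y ^ 2) by (split; [apply pow2_ge_0|apply pow_incr; lra]).
    split.
    + unfold Rdiv. rewrite Rmult_comm. apply Rmult_le_compat_r; [lra|].
      apply Rinv_le_contravar; lra.
    + rewrite <- (Rmult_1_l y) at 2. apply Rmult_le_compat_r; [lra|].
      rewrite <- Rinv_1. apply Rinv_le_contravar; lra.
Qed.

Lemma angle_eq_atan (t x : R) : 0 < t -> 0 < x -> angle t x = atan (t / x).
Proof.
  intros Ht Hx. unfold angle. replace (t / x) with (/ (x / t)) by (field; lra).
  symmetry; apply atan_inv. now apply Rdiv_lt_0_compat.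
Qed.

Lemma is_lim_seq_inv_S (c : R) : is_lim_seq (fun n => c / INR (S n)) 0.
Proof.
  replace (Finite 0) with (Rbar_mult c 0) by (simpl; f_equal; ring).
  apply is_lim_seq_scal_l.
  apply (is_lim_seq_ext (fun n => / INR (S n))); [reflexivity|].
  apply (is_lim_seq_incr_1 (fun n => / INR n)).
  replace (Finite 0) with (Rbar_inv p_infty) by reflexivity.
  apply is_lim_seq_inv; [apply is_lim_seq_INR|discriminate].
Qed.

Lemma angle_limit (t : R) : 0 < t -> is_lim_seq (fun n => angle t (INR (S n))) 0.
Proof.
  intros Ht. apply (is_lim_seq_le_le (fun _ => 0) _ (fun n => t / INR (S n))).
  - intros n. assert (Hn : 0 < INR (S n)) by (apply lt_0_INR; lia).
    rewrite angle_eq_atan by assumption.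
    pose proof (Rdiv_lt_0_compat _ _ Ht Hn) as Hq.
    pose proof (atan_bounds (t / INR (S n)) ltac:(lra)) as H.
    assert (0 <= t / INR (S n) / (1 + (t / INR (S n)) ^ 2)).
    { apply Rdiv_le_0_compat; [lra|]. pose proof (pow2_ge_0 (t / INR (S n))); lra. }
    lra.
  - apply is_lim_seq_const.
  - apply is_lim_seq_inv_S.
Qed.

Lemma angle_deriv_limit (t : R) (m : nat) : 0 < t ->
  is_lim_seq (fun n => angle_deriv t (S m) (INR (S n))) 0.
Proof.
  intros Ht.
  set (h := fun a => (-1) ^ S m * INR (fact m) / t ^ S m * (sin a ^ S m * sin (INR (S m) * a))).
  replace 0 with (h 0) by (unfold h; rewrite Rmult_0_r, sin_0; ring).
  apply (is_lim_seq_continuous h (fun n => angle t (INR (S n))) 0);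
    [|now apply angle_limit].
  apply derivable_continuous_pt. exists (Derive h 0). apply is_derive_Reals, Derive_correct.
  unfold h. auto_derive. easy.
Qed.

(** The source of the term -t in t ln t - t: x angle t x tends to t, since
    angle t x is atan (t/x) for x > 0. *)
Lemma angle_primitive_limit (t : R) : 0 < t ->
  is_lim_seq (fun n => angle_primitive t (INR (S n)) - t * ln (INR n)) t.
Proof.
  intros Ht.
  assert (L1 : is_lim_seq (fun n => INR (S n) * angle t (INR (S n))) t).
  { apply (is_lim_seq_le_le (fun n => t / (1 + (t / INR (S n)) ^ 2)) _ (fun _ => t)).
    - intros n. assert (Hn : 0 < INR (S n)) by (apply lt_0_INR; lia).
      rewrite angle_eq_atan by assumption. set (x := INR (S n)) in *.
      pose proof (Rdiv_lt_0_compat _ _ Ht Hn) as Hq.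
      destruct (atan_bounds (t / x) ltac:(lra)) as [H1 H2].
      apply (Rmult_le_compat_l x) in H1; [|lra]. apply (Rmult_le_compat_l x) in H2; [|lra].
      pose proof (pow2_ge_0 (t / x)) as Hs.
      replace (x * (t / x / (1 + (t / x) ^ 2))) with (t / (1 + (t / x) ^ 2)) in H1.
      2: { field. split; nra. }
      replace (x * (t / x)) with t in H2 by (field; lra). lra.
    - replace (Finite t) with (Finite (t / (1 + 0 ^ 2))) by (f_equal; field).
      apply (is_lim_seq_continuous (fun y => t / (1 + y ^ 2)) (fun n => t / INR (S n)) 0);
        [|apply is_lim_seq_inv_S].
      apply derivable_continuous_pt. eexists. apply is_derive_Reals.
      auto_derive; [lra|reflexivity].
    - apply is_lim_seq_const. }
  assert (L2 : is_lim_seq (fun n => t / 2 * ln ((1 + 1 / INR n) ^ 2 + (t / INR n) ^ 2)) 0).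
  { apply is_lim_seq_incr_1.
    replace 0 with (t / 2 * ln ((1 + 0) ^ 2 + (t * 0) ^ 2)).
    2: { replace ((1 + 0) ^ 2 + (t * 0) ^ 2) with 1 by ring. rewrite ln_1; ring. }
    apply (is_lim_seq_ext (fun n =>
      t / 2 * ln ((1 + 1 / INR (S n)) ^ 2 + (t * (1 / INR (S n))) ^ 2))).
    { intros n. do 4 f_equal. unfold Rdiv; ring. }
    apply (is_lim_seq_continuous (fun y => t / 2 * ln ((1 + y) ^ 2 + (t * y) ^ 2))
      (fun n => 1 / INR (S n)) 0); [|apply is_lim_seq_inv_S].
    apply derivable_continuous_pt. eexists. apply is_derive_Reals.
    auto_derive; [|reflexivity]. lra. }
  apply (is_lim_seq_ext_loc (fun n => INR (S n) * angle t (INR (S n))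
     + t / 2 * ln ((1 + 1 / INR n) ^ 2 + (t / INR n) ^ 2))).
  - exists 1%nat. intros n Hn. unfold angle_primitive.
    assert (Hp : 0 < INR n) by (apply lt_0_INR; lia).
    replace (INR (S n) ^ 2 + t ^ 2) with
      (((1 + 1 / INR n) ^ 2 + (t / INR n) ^ 2) * (INR n * INR n)).
    2: { rewrite S_INR. field. lra. }
    assert (0 < 1 / INR n) by (apply Rdiv_lt_0_compat; lra).
    rewrite ln_mult, ln_mult; try lra.
    + pose proof (pow2_ge_0 (t / INR n)). nra.
    + nra.
  - replace (Finite t) with (Finite (t + 0)) by (f_equal; ring).
    apply (is_lim_seq_plus' _ _ t 0); assumption.
Qed.

(** * The expansion of the limiting phase *)

(** The majorant of the derivative of order 2k is (2k-1)! (cos b / t)^(2k) with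
    b = atan (x/t), and db/dx = cos^2 b / t, so that its primitive is a multiple of
    that of cos^(2k-2) at b, which stays below the Wallis integral. *)
Lemma midpoint_angle_sum_bound (t : R) (k N : nat) : 0 < t -> (1 <= k)%nat ->
  let c j := bernoulli_poly (2 * j) (1 / 2) / INR (fact (2 * j)) in
  Rabs (sum_f_R0 (fun m => angle t (INR m + 1 / 2)) N
        - (angle_primitive t (INR (S N)) - t * ln t)
        - (sum_n_m (fun j => c j * angle_deriv t (2 * j - 1) (INR (S N))) 1 k
           - sum_n_m (fun j => c j * angle_deriv t (2 * j - 1) 0) 1 k))
  <= Rabs (bernoulli (2 * k)) / (2 * INR k * t ^ (2 * k - 1)) * wallis (2 * k - 2).
Proof.
  intros Ht Hk c.
  set (G := fun x => INR (fact (2 * k - 1)) / t ^ (2 * k - 1)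
              * cos_pow_primitive (2 * k - 2) (atan (x / t))).
  set (g := fun x => INR (fact (2 * k - 1)) / t ^ (2 * k) * sin (angle t x) ^ (2 * k)).
  apply Rle_trans with
    (Rabs (bernoulli (2 * k)) / INR (fact (2 * k)) * (G (INR (S N)) - G 0)).
  - replace (t * ln t) with (angle_primitive t 0).
    + apply (midpoint_euler_maclaurin (angle_deriv t) (angle_primitive t) G g); [exact Hk| | | |].
      * intros n x. now apply angle_deriv_derive.
      * intros x. now apply angle_primitive_derive.
      * intros x. unfold G, g. rewrite sin_angle.
        apply (is_derive_Rext (fun x => INR (fact (2 * k - 1)) / t ^ (2 * k - 1)
              * cos_pow_primitive (2 * k - 2) (atan (x / t))) _ _
          (INR (fact (2 * k - 1)) / t ^ (2 * k - 1)
            * (cos (atan (x / t)) ^ (2 * k - 2) * (cos (atan (x / t)) ^ 2 / t)))); [reflexivity| |].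
        { replace (t ^ (2 * k)) with (t * t ^ (2 * k - 1)).
          2: { change (t ^ S (2 * k - 1) = t ^ (2 * k)). f_equal; lia. }
          replace (cos (atan (x / t)) ^ (2 * k)) with
            (cos (atan (x / t)) ^ (2 * k - 2) * cos (atan (x / t)) ^ 2).
          2: { rewrite <- pow_add. f_equal; lia. }
          field. split; try apply pow_nonzero; lra. }
        apply is_derive_scal.
        apply (is_derive_Rcomp (cos_pow_primitive (2 * k - 2)) (fun y => atan (y / t))).
        { apply cos_pow_primitive_derive. } now apply atan_scaled_derive.
      * intros x. unfold g. replace (2 * k)%nat with (S (2 * k - 1)) by lia.
        unfold angle_deriv. replace (S (2 * k - 1) - 1)%nat with (2 * k - 1)%nat by lia.
        replace (S (2 * k - 1)) with (2 * k)%nat by lia.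
        rewrite pow_1_even, Rmult_1_l, sin_angle.
        set (s := cos (atan (x / t)) ^ (2 * k)).
        assert (Hs : 0 <= s) by (unfold s; rewrite pow_mult; apply pow_le, pow2_ge_0).
        assert (Hf : 0 <= INR (fact (2 * k - 1)) / t ^ (2 * k)).
        { apply Rdiv_le_0_compat; [apply pos_INR|now apply pow_lt]. }
        rewrite Rabs_mult, (Rabs_pos_eq _ Hf). apply Rmult_le_compat_l; [exact Hf|].
        rewrite Rabs_mult, (Rabs_pos_eq _ Hs).
        rewrite <- (Rmult_1_r s) at 2. apply Rmult_le_compat_l; [exact Hs|].
        apply Rabs_le, SIN_bound.
    + unfold angle_primitive. rewrite Rmult_0_l, Rplus_0_l.
      replace (0 ^ 2 + t ^ 2) with (t * t) by ring. rewrite ln_mult by lra. field.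
  - unfold G. replace (0 / t) with 0 by (field; lra). rewrite atan_0, cos_pow_primitive_0.
    rewrite Rmult_0_r, Rminus_0_r.
    replace (fact (2 * k)) with (2 * k * fact (2 * k - 1))%nat.
    2: { replace (2 * k)%nat with (S (2 * k - 1)) at 3 by lia. rewrite fact_simpl.
         f_equal; lia. }
    assert (Hp : 0 < t ^ (2 * k - 1)) by now apply pow_lt.
    assert (HK : 0 < INR k) by (apply lt_0_INR; lia).
    rewrite !mult_INR. simpl (INR 2).
    replace (_ * _) with (Rabs (bernoulli (2 * k)) / (2 * INR k * t ^ (2 * k - 1))
      * cos_pow_primitive (2 * k - 2) (atan (INR (S N) / t))).
    2: { field. repeat split; try lra. apply INR_fact_neq_0. }
    apply Rmult_le_compat_l.
    + apply Rdiv_le_0_compat; [apply Rabs_pos|]. apply Rmult_lt_0_compat; lra.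
    + apply cos_pow_primitive_le_wallis. pose proof (atan_bound (INR (S N) / t)). lra.
Qed.

Lemma is_lim_seq_sum_n_m (u : nat -> nat -> R) (k : nat) :
  (forall j, (1 <= j)%nat -> is_lim_seq (u j) 0) ->
  is_lim_seq (fun n => sum_n_m (fun j => u j n) 1 k) 0.
Proof.
  intros H. induction k as [|k IH].
  - apply (is_lim_seq_ext (fun _ => 0)); [|apply is_lim_seq_const].
    intros n. rewrite sum_n_m_zero by lia. reflexivity.
  - apply (is_lim_seq_ext (fun n => sum_n_m (fun j => u j n) 1 k + u (S k) n)).
    + intros n. symmetry. apply (sum_n_Sm (fun j => u j n)). lia.
    + replace (Finite 0) with (Finite (0 + 0)) by (f_equal; ring).
      apply (is_lim_seq_plus' _ _ 0 0); [exact IH|apply H; lia].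
Qed.

(** The argument of the n-th approximant in Euler's limit for Gamma(1/2 + it),
    chosen continuous in t. *)
Definition gamma_phase (n : nat) (t : R) : R :=
  t * ln (INR n) - sum_f_R0 (fun m => atan (t / (INR m + 1 / 2))) n.

(** The imaginary part of That j at it, and for t > 0 also the modulus
    of That j at t. *)
Definition That_im (j : nat) (t : R) : R :=
  Rabs (bernoulli_poly (2 * j) (1 / 2)) / (2 * INR j * (2 * INR j - 1) * t ^ (2 * j - 1)).

Lemma angle_deriv_That_im (t : R) (j : nat) : 0 < t -> (1 <= j)%nat ->
  bernoulli_poly (2 * j) (1 / 2) / INR (fact (2 * j)) * angle_deriv t (2 * j - 1) 0
  = That_im j t.
Proof.
  intros Ht Hj. rewrite angle_deriv_at_0 by assumption. unfold That_im.
  rewrite (proj1 (bernoulli_half_abs j Hj)).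
  replace (fact (2 * j)) with (2 * j * (2 * j - 1) * fact (2 * j - 2))%nat.
  2: { replace (2 * j)%nat with (S (S (2 * j - 2))) at 4 by lia. rewrite !fact_simpl.
       replace (S (S (2 * j - 2))) with (2 * j)%nat by lia.
       replace (S (2 * j - 2)) with (2 * j - 1)%nat by lia. lia. }
  rewrite !mult_INR, minus_INR, mult_INR by lia. simpl (INR 2). simpl (INR 1).
  assert (1 <= INR j) by (apply (le_INR 1); lia).
  field. repeat split; try lra; [apply pow_nonzero; lra|apply INR_fact_neq_0].
Qed.

Lemma gamma_phase_limit_bound (t theta : R) (k : nat) : 0 < t -> (1 <= k)%nat ->
  is_lim_seq (fun n => gamma_phase n t) theta ->
  Rabs (theta - (t * ln t - t + sum_n_m (fun j => That_im j t) 1 k))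
  <= Rabs (bernoulli (2 * k)) / (2 * INR k * t ^ (2 * k - 1)) * wallis (2 * k - 2).
Proof.
  intros Ht Hk Hlim.
  set (c := fun j => bernoulli_poly (2 * j) (1 / 2) / INR (fact (2 * j))).
  set (D := fun n => sum_n_m (fun j => c j * angle_deriv t (2 * j - 1) (INR (S n))) 1 k).
  set (Z := sum_n_m (fun j => That_im j t) 1 k).
  set (E := Rabs (bernoulli (2 * k)) / (2 * INR k * t ^ (2 * k - 1)) * wallis (2 * k - 2)).
  assert (Hle : forall n, Rabs (gamma_phase n t
     + (angle_primitive t (INR (S n)) - t * ln (INR n)) - t * ln t + (D n - Z)) <= E).
  { intros n. pose proof (midpoint_angle_sum_bound t k n Ht Hk) as H. cbv zeta in H.
    fold E in H. rewrite <- Rabs_Ropp.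
    replace Z with (sum_n_m (fun j => c j * angle_deriv t (2 * j - 1) 0) 1 k).
    2: { apply sum_n_m_ext_loc. intros j Hj. apply angle_deriv_That_im; [assumption|lia]. }
    eapply Rle_trans; [|exact H]. apply Req_le. f_equal. unfold gamma_phase.
    rewrite (sum_eq (fun m => atan (t / (INR m + 1 / 2))) (fun m => angle t (INR m + 1 / 2))).
    - unfold D, c. ring.
    - intros i _. symmetry. apply angle_eq_atan; [assumption|]. pose proof (pos_INR i). lra. }
  assert (HD : is_lim_seq D 0).
  { apply (is_lim_seq_sum_n_m (fun j n => c j * angle_deriv t (2 * j - 1) (INR (S n)))).
    intros j Hj. replace (Finite 0) with (Rbar_mult (c j) 0) by (simpl; f_equal; ring).
    apply is_lim_seq_scal_l. replace (2 * j - 1)%nat with (S (2 * j - 2)) by lia.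
    now apply angle_deriv_limit. }
  assert (HL : is_lim_seq (fun n => Rabs (gamma_phase n t
     + (angle_primitive t (INR (S n)) - t * ln (INR n)) - t * ln t + (D n - Z)))
     (Rabs (theta + t - t * ln t + (0 - Z)))).
  { apply (is_lim_seq_abs _ (theta + t - t * ln t + (0 - Z))).
    apply is_lim_seq_plus'; [apply is_lim_seq_minus'; [apply is_lim_seq_plus'|]|
      apply is_lim_seq_minus']; auto using is_lim_seq_const.
    now apply angle_primitive_limit. }
  pose proof (is_lim_seq_le _ _ _ _ Hle HL (is_lim_seq_const E)) as H. simpl in H.
  eapply Rle_trans; [|exact H]. apply Req_le. f_equal. ring.
Qed.

(** * Convergence and continuity of the phases *)

Lemma atan_div_increment (a s t : R) : 0 < a -> s <= t ->
  0 <= atan (t / a) - atan (s / a) <= (t - s) / a.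
Proof.
  intros Ha Hst. assert (Hi : 0 < / a) by now apply Rinv_0_lt_compat.
  assert (Hc : forall y, 0 <= cos (atan (y / a)) ^ 2 / a <= / a).
  { intros y. pose proof (COS_bound (atan (y / a))). pose proof (pow2_ge_0 (cos (atan (y / a)))).
    unfold Rdiv. split; [nra|]. assert (cos (atan (y / a)) ^ 2 <= 1) by nra. nra. }
  split.
  - assert (atan (s / a) <= atan (t / a)); [|lra].
    apply (derive_nonneg_le (fun y => atan (y / a)) (fun y => cos (atan (y / a)) ^ 2 / a)); [lra| |].
    + intros; now apply atan_scaled_derive.
    + intros; apply Hc.
  - assert (s / a - atan (s / a) <= t / a - atan (t / a)); [|unfold Rdiv in *; lra].
    apply (derive_nonneg_le (fun y => y / a - atan (y / a))
      (fun y => / a - cos (atan (y / a)) ^ 2 / a)); [lra| |].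
    + intros; apply is_derive_Rminus; [auto_derive; [easy|ring]|now apply atan_scaled_derive].
    + intros x _. specialize (Hc x). lra.
Qed.

Lemma ln_succ_bounds (p : R) : 0 < p -> / (p + 1) <= ln (p + 1) - ln p <= / p.
Proof.
  intros Hp. destruct (MVT_cor2 ln Rinv p (p + 1)) as [c [E Hc]]; [lra| |].
  - intros; apply derivable_pt_lim_ln; lra.
  - rewrite E. replace (p + 1 - p) with 1 by ring. rewrite Rmult_1_r.
    split; apply Rinv_le_contravar; lra.
Qed.

Definition phase_step (p t : R) : R := t * (ln (p + 1) - ln p) - atan (t / (p + 3 / 2)).

Lemma gamma_phase_step (n : nat) (t : R) :
  gamma_phase (S n) t = gamma_phase n t + phase_step (INR n) t.
Proof.
  unfold gamma_phase, phase_step. rewrite tech5, S_INR.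
  replace (INR n + 1 + 1 / 2) with (INR n + 3 / 2) by field. ring.
Qed.

(** The derivative in t of a step is ln (p+1) - ln p - a / (a^2 + t^2) with
    a = p + 3/2, which is nonnegative because a > p + 1 and is O(1/p^2) uniformly
    for |t| <= T.  The bound is given in telescoping form. *)
Lemma phase_step_increment (p s t T : R) : 1 <= p -> - T <= s -> s <= t -> t <= T ->
  0 <= phase_step p t - phase_step p s <= (3 / 2 + T ^ 2) * (/ p - / (p + 1)) * (t - s).
Proof.
  intros Hp Hs Hst Ht. pose proof (ln_succ_bounds p ltac:(lra)) as HL.
  set (l := ln (p + 1) - ln p) in *. set (a := p + 3 / 2).
  assert (Hd : forall y, is_derive (phase_step p) y (l - cos (atan (y / a)) ^ 2 / a)).
  { intros y. apply is_derive_Rminus; [auto_derive; [easy|]; unfold l; ring|].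
    apply atan_scaled_derive. unfold a; lra. }
  assert (Ha : 0 < a) by (unfold a; lra).
  set (M := (3 / 2 + T ^ 2) * (/ p - / (p + 1))).
  assert (Hb : forall y, s <= y <= t -> 0 <= l - cos (atan (y / a)) ^ 2 / a <= M).
  { intros y Hy. rewrite cos_atan_sqr.
    assert (Hy2 : 0 <= y ^ 2 <= T ^ 2).
    { split; [apply pow2_ge_0|]. assert (0 <= (T - y) * (T + y)) by (apply Rmult_le_pos; lra). lra. }
    assert (Hay : 0 < a ^ 2 + y ^ 2) by (pose proof (pow_lt a 2 Ha); lra).
    assert (E : / (1 + (y / a) ^ 2) / a = / a - y ^ 2 / (a * (a ^ 2 + y ^ 2))).
    { field. repeat split; nra. }
    rewrite E.
    assert (P1 : / a <= / (p + 1)) by (apply Rinv_le_contravar; unfold a; lra).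
    assert (P2 : 0 <= y ^ 2 / (a * (a ^ 2 + y ^ 2))) by (apply Rdiv_le_0_compat; nra).
    split; [lra|].
    assert (Hpp : 0 < p * (p + 1)) by nra.
    assert (P3 : y ^ 2 / (a * (a ^ 2 + y ^ 2)) <= T ^ 2 * / (p * (p + 1))).
    { apply Rmult_le_compat; [lra| |lra|].
      - apply Rlt_le, Rinv_0_lt_compat. nra.
      - apply Rinv_le_contravar; [exact Hpp|]. assert (1 <= a) by (unfold a; lra).
        assert (p * (p + 1) <= a * a) by (unfold a; nra).
        assert (a * a <= a ^ 2 + y ^ 2) by nra. nra. }
    assert (P4 : / p - / a <= 3 / 2 * / (p * (p + 1))).
    { replace (/ p - / a) with (3 / 2 * / (p * a)) by (unfold a; field; lra).
      apply Rmult_le_compat_l; [lra|]. apply Rinv_le_contravar; unfold a; nra. }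
    unfold M. replace (/ p - / (p + 1)) with (/ (p * (p + 1))) by (field; lra). lra. }
  split.
  - assert (phase_step p s <= phase_step p t); [|lra].
    apply (derive_nonneg_le (phase_step p) (fun y => l - cos (atan (y / a)) ^ 2 / a));
      [lra|intros; apply Hd|intros; apply Hb; lra].
  - assert (M * s - phase_step p s <= M * t - phase_step p t); [|lra].
    apply (derive_nonneg_le (fun y => M * y - phase_step p y)
      (fun y => M - (l - cos (atan (y / a)) ^ 2 / a))); [lra| |].
    + intros; apply is_derive_Rminus; [auto_derive; [easy|ring]|apply Hd].
    + intros x Hx. specialize (Hb x). lra.
Qed.

(** A Lipschitz constant independent of n passes to the limit and makes it
    continuous. *)
Lemma gamma_phase_lipschitz (n : nat) (s t T : R) : - T <= s -> s <= t -> t <= T ->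
  Rabs (gamma_phase (S n) t - gamma_phase (S n) s) <= (9 / 2 + T ^ 2) * (t - s).
Proof.
  intros Hs Hst Ht.
  assert (Base : - 3 * (t - s) <= gamma_phase 1 t - gamma_phase 1 s <= 0).
  { unfold gamma_phase. simpl. rewrite ln_1.
    pose proof (atan_div_increment (0 + 1 / 2) s t ltac:(lra) Hst).
    pose proof (atan_div_increment (1 + 1 / 2) s t ltac:(lra) Hst). lra. }
  assert (Step : 0 <= (gamma_phase (S n) t - gamma_phase (S n) s)
                      - (gamma_phase 1 t - gamma_phase 1 s)
                 <= (3 / 2 + T ^ 2) * (1 - / INR (S n)) * (t - s)).
  { clear Base. induction n as [|n IH].
    - simpl. rewrite Rinv_1. lra.
    - rewrite (gamma_phase_step (S n) t), (gamma_phase_step (S n) s).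
      pose proof (phase_step_increment (INR (S n)) s t T) as P.
      rewrite <- S_INR in P.
      specialize (P ltac:(apply (le_INR 1); lia) Hs Hst Ht). lra. }
  assert (0 < / INR (S n)) by (apply Rinv_0_lt_compat, lt_0_INR; lia).
  pose proof (pow2_ge_0 T).
  assert ((3 / 2 + T ^ 2) * (1 - / INR (S n)) * (t - s) <= (3 / 2 + T ^ 2) * 1 * (t - s)).
  { apply Rmult_le_compat_r; [lra|]. apply Rmult_le_compat_l; lra. }
  apply Rabs_le. nra.
Qed.

Lemma gamma_phase_at_0 (n : nat) : gamma_phase n 0 = 0.
Proof.
  unfold gamma_phase. rewrite Rmult_0_l, Rminus_0_l.
  rewrite sum_eq_R0; [ring|]. intros m _. unfold Rdiv. rewrite Rmult_0_l. apply atan_0.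
Qed.

Lemma phase_step_at_0 (p : R) : phase_step p 0 = 0.
Proof. unfold phase_step, Rdiv. rewrite !Rmult_0_l, atan_0. ring. Qed.

Definition gamma_phase_lim (t : R) : R := Lim_seq (fun n => gamma_phase n t).

(** The steps vanish at t = 0 and are nondecreasing in t, so the phases are
    monotone in n, and the Lipschitz estimate bounds them. *)
Lemma gamma_phase_converges (t : R) :
  is_lim_seq (fun n => gamma_phase n t) (gamma_phase_lim t).
Proof.
  apply Lim_seq_correct'.
  enough (H : ex_finite_lim_seq (fun n => gamma_phase (S n) t)).
  { destruct H as [l Hl]. exists l. now apply is_lim_seq_incr_1. }
  destruct (Rle_dec 0 t) as [H0|H0].
  - apply (ex_finite_lim_seq_incr _ ((9 / 2 + t ^ 2) * (t - 0))); intros n.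
    + rewrite (gamma_phase_step (S n)).
      pose proof (phase_step_increment (INR (S n)) 0 t t) as P. rewrite phase_step_at_0 in P.
      specialize (P ltac:(apply (le_INR 1); lia)). lra.
    + pose proof (gamma_phase_lipschitz n 0 t t ltac:(lra) ltac:(lra) ltac:(lra)) as P.
      rewrite gamma_phase_at_0 in P. apply Rabs_le_between in P. lra.
  - apply (ex_finite_lim_seq_decr _ (- ((9 / 2 + (- t) ^ 2) * (0 - t)))); intros n.
    + rewrite (gamma_phase_step (S n)).
      pose proof (phase_step_increment (INR (S n)) t 0 (- t)) as P. rewrite phase_step_at_0 in P.
      specialize (P ltac:(apply (le_INR 1); lia)). lra.
    + pose proof (gamma_phase_lipschitz n t 0 (- t) ltac:(lra) ltac:(lra) ltac:(lra)) as P.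
      rewrite gamma_phase_at_0 in P. apply Rabs_le_between in P. lra.
Qed.

Lemma gamma_phase_lim_at_0 : gamma_phase_lim 0 = 0.
Proof.
  unfold gamma_phase_lim. rewrite (Lim_seq_ext _ (fun _ => 0)); [|apply gamma_phase_at_0].
  now rewrite Lim_seq_const.
Qed.

Lemma gamma_phase_lim_lipschitz (s t T : R) : Rabs s <= T -> Rabs t <= T ->
  Rabs (gamma_phase_lim t - gamma_phase_lim s) <= (9 / 2 + T ^ 2) * Rabs (t - s).
Proof.
  intros Hs Ht. apply Rabs_le_between in Hs. apply Rabs_le_between in Ht.
  assert (Hn : forall n, Rabs (gamma_phase (S n) t - gamma_phase (S n) s)
     <= (9 / 2 + T ^ 2) * Rabs (t - s)).
  { intros n. destruct (Rle_dec s t).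
    - rewrite (Rabs_pos_eq (t - s)) by lra. apply gamma_phase_lipschitz; lra.
    - rewrite (Rabs_minus_sym (gamma_phase (S n) t)), (Rabs_minus_sym t), (Rabs_pos_eq (s - t)) by lra.
      apply gamma_phase_lipschitz; lra. }
  assert (L : forall u, is_lim_seq (fun n => gamma_phase (S n) u) (gamma_phase_lim u)).
  { intros u. rewrite <- (is_lim_seq_incr_1 (fun n => gamma_phase n u)).
    apply gamma_phase_converges. }
  exact (is_lim_seq_le _ _ _ _ Hn
    (is_lim_seq_abs _ (gamma_phase_lim t - gamma_phase_lim s) (is_lim_seq_minus' _ _ _ _ (L t) (L s)))
    (is_lim_seq_const _)).
Qed.

Lemma gamma_phase_lim_continuous : continuity gamma_phase_lim.
Proof.
  intros s eps Heps. set (K := 9 / 2 + (Rabs s + 1) ^ 2).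
  assert (HK : 0 < K) by (unfold K; pose proof (pow2_ge_0 (Rabs s + 1)); lra).
  exists (Rmin 1 (eps / K)). split.
  { apply Rmin_glb_lt; [lra|now apply Rdiv_lt_0_compat]. }
  intros t [_ Hd]. simpl in Hd |- *. unfold Rdist in *.
  pose proof (Rmin_l 1 (eps / K)). pose proof (Rmin_r 1 (eps / K)).
  eapply Rle_lt_trans.
  - apply (gamma_phase_lim_lipschitz s t (Rabs s + 1)); [lra|].
    replace t with (s + (t - s)) by ring.
    pose proof (Rabs_triang s (t - s)). lra.
  - fold K. rewrite Rmult_comm. apply Rlt_div_r; [exact HK|]. lra.
Qed.

(** * The imaginary part of log Gamma on the critical line *)

Definition polar (r a : R) : C := (r * cos a, r * sin a).

Lemma polar_mult (r s a b : R) : (polar r a * polar s b)%C = polar (r * s) (a + b).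
Proof. unfold polar, Cmult; simpl. rewrite cos_plus, sin_plus. f_equal; ring. Qed.

Lemma polar_inv (r a : R) : 0 < r -> (/ polar r a)%C = polar (/ r) (- a).
Proof.
  intros Hr. unfold polar, Cinv; simpl. rewrite cos_neg, sin_neg.
  pose proof (sin2_cos2 a) as T. unfold Rsqr in T.
  assert (E : r * cos a * (r * cos a * 1) + r * sin a * (r * sin a * 1) = r * r).
  { transitivity (r * r * (sin a * sin a + cos a * cos a)); [ring|rewrite T; ring]. }
  rewrite E. f_equal; field; lra.
Qed.

Lemma polar_of_right_half_plane (x t : R) : 0 < x ->
  exists r, 0 < r /\ ((x, t) : C) = polar r (atan (t / x)).
Proof.
  intros Hx. assert (Hq : 0 < sqrt (1 + (t / x)²)).
  { apply sqrt_lt_R0. pose proof (Rle_0_sqr (t / x)). lra. }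
  exists (x * sqrt (1 + (t / x)²)). split; [now apply Rmult_lt_0_compat|].
  unfold polar. rewrite cos_atan, sin_atan. f_equal; field; lra.
Qed.

Lemma rising_polar (t : R) (n : nat) :
  exists r, 0 < r /\
    rising ((1 / 2)%R, t) (S n) = polar r (sum_f_R0 (fun m => atan (t / (INR m + 1 / 2))) n).
Proof.
  assert (Factor : forall m, exists r, 0 < r /\
    (((1 / 2)%R, t) + INR m)%C = polar r (atan (t / (INR m + 1 / 2)))).
  { intros m. pose proof (pos_INR m).
    destruct (polar_of_right_half_plane (INR m + 1 / 2) t) as [r [Hr E]]; [lra|].
    exists r. split; [exact Hr|]. rewrite <- E. unfold Cplus, RtoC; simpl. f_equal; ring. }
  induction n as [|n [r [Hr E]]].
  - destruct (Factor 0%nat) as [r [Hr E]]. exists r. split; [exact Hr|].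
    transitivity (RtoC 1 * (((1 / 2)%R, t) + INR 0))%C; [reflexivity|].
    rewrite E. apply Cmult_1_l.
  - destruct (Factor (S n)) as [s [Hs Es]]. exists (r * s). split; [now apply Rmult_lt_0_compat|].
    rewrite tech5, <- polar_mult, <- E, <- Es. reflexivity.
Qed.

Lemma gamma_approximant_polar (t : R) (n : nat) :
  exists r, 0 < r /\
    (INR (fact n) * Cexp (((1 / 2)%R, t) * ln (INR n)) / rising ((1 / 2)%R, t) (n + 1))%C
    = polar r (gamma_phase n t).
Proof.
  rewrite Nat.add_1_r. destruct (rising_polar t n) as [r [Hr ->]].
  exists (INR (fact n) * exp (1 / 2 * ln (INR n)) * / r). split.
  - repeat apply Rmult_lt_0_compat; [apply INR_fact_lt_0|apply exp_pos|now apply Rinv_0_lt_compat].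
  - unfold Cdiv. rewrite polar_inv by exact Hr.
    replace (INR (fact n) * Cexp (((1 / 2)%R, t) * ln (INR n)))%C with
      (polar (INR (fact n) * exp (1 / 2 * ln (INR n))) (t * ln (INR n))).
    + rewrite polar_mult. reflexivity.
    + unfold polar, Cexp, Cmult, RtoC; simpl.
      replace (1 / 2 * ln (INR n) - t * 0) with (1 / 2 * ln (INR n)) by ring.
      replace (1 / 2 * 0 + t * ln (INR n)) with (t * ln (INR n)) by ring.
      f_equal; ring.
Qed.

(** The n-th approximant is a positive multiple of e^(i theta_n).  Its components
    along and across that direction have limits, so the limit of the approximants is
    a nonnegative multiple of e^(i theta); being nonzero, it has argument theta
    modulo 2 PI. *)
Lemma gamma_phase_congruent (t rho phi : R) :
  is_Gamma ((1 / 2)%R, t) (Cexp (rho, phi)) -> cos (gamma_phase_lim t - phi) = 1.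
Proof.
  intros H. set (theta := gamma_phase_lim t).
  set (X := fun n => fst (INR (fact n) * Cexp (((1 / 2)%R, t) * ln (INR n)) / rising ((1 / 2)%R, t) (n + 1))%C).
  set (Y := fun n => snd (INR (fact n) * Cexp (((1 / 2)%R, t) * ln (INR n)) / rising ((1 / 2)%R, t) (n + 1))%C).
  assert (HX : is_lim_seq X (exp rho * cos phi)).
  { exact (filterlim_comp _ _ _ _ fst _ _ _ H
      (continuous_fst (U := R_UniformSpace) (V := R_UniformSpace) _ _)). }
  assert (HY : is_lim_seq Y (exp rho * sin phi)).
  { exact (filterlim_comp _ _ _ _ snd _ _ _ H
      (continuous_snd (U := R_UniformSpace) (V := R_UniformSpace) _ _)). }
  assert (HC : is_lim_seq (fun n => cos (gamma_phase n t)) (cos theta)).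
  { apply (is_lim_seq_continuous cos); [apply continuity_cos|apply gamma_phase_converges]. }
  assert (HS : is_lim_seq (fun n => sin (gamma_phase n t)) (sin theta)).
  { apply (is_lim_seq_continuous sin); [apply continuity_sin|apply gamma_phase_converges]. }
  assert (E1 : exp rho * cos phi * sin theta - exp rho * sin phi * cos theta = 0).
  { assert (L : is_lim_seq (fun n => X n * sin (gamma_phase n t) - Y n * cos (gamma_phase n t))
      (exp rho * cos phi * sin theta - exp rho * sin phi * cos theta)).
    { apply is_lim_seq_minus'; apply is_lim_seq_mult'; assumption. }
    apply is_lim_seq_unique in L. rewrite (Lim_seq_ext _ (fun _ => 0)), Lim_seq_const in L.
    - now injection L.
    - intros n. unfold X, Y. destruct (gamma_approximant_polar t n) as [r [_ ->]].
      simpl. ring. }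
  assert (E2 : 0 <= exp rho * cos phi * cos theta + exp rho * sin phi * sin theta).
  { assert (L : is_lim_seq (fun n => X n * cos (gamma_phase n t) + Y n * sin (gamma_phase n t))
      (exp rho * cos phi * cos theta + exp rho * sin phi * sin theta)).
    { apply is_lim_seq_plus'; apply is_lim_seq_mult'; assumption. }
    apply (fun P => is_lim_seq_le (fun _ => 0) _ 0 _ P (is_lim_seq_const 0) L).
    intros n. unfold X, Y. destruct (gamma_approximant_polar t n) as [r [Hr ->]]. simpl.
    set (a := gamma_phase n t). pose proof (Rle_0_sqr (cos a)). pose proof (Rle_0_sqr (sin a)).
    unfold Rsqr in *. nra. }
  pose proof (exp_pos rho) as He.
  assert (S0 : sin (theta - phi) = 0).
  { rewrite sin_minus. apply Rmult_eq_reg_l with (exp rho); lra. }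
  assert (C0 : 0 <= cos (theta - phi)).
  { rewrite cos_minus. apply Rmult_le_reg_l with (exp rho); lra. }
  pose proof (sin2_cos2 (theta - phi)) as T. rewrite S0 in T. unfold Rsqr in T. nra.
Qed.

(** By the intermediate value theorem a nonzero value of d would force d to take a
    nonzero value in [-1, 1], where the cosine is not 1. *)
Lemma continuous_lift_unique (d : R -> R) (t : R) : continuity d ->
  d 0 = 0 -> (forall x, cos (d x) = 1) -> d t = 0.
Proof.
  assert (Upper : forall f, continuity f -> f 0 = 0 -> (forall x, cos (f x) = 1) -> f t <= 0).
  { clear d. intros f Hf H0 Hcos. apply Rnot_lt_le. intros Hpos.
    pose proof (Rmin_l (f t) 1) as M1. pose proof (Rmin_r (f t) 1) as M2.
    assert (M0 : 0 < Rmin (f t) 1) by (apply Rmin_glb_lt; lra).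
    destruct (IVT_gen f 0 t (Rmin (f t) 1) Hf) as [x [_ Hx]].
    { rewrite H0, Rmin_left, Rmax_right by lra. lra. }
    specialize (Hcos x). rewrite Hx in Hcos.
    assert (cos (Rmin (f t) 1) < cos 0); [|rewrite cos_0 in *; lra].
    pose proof PI2_1. apply cos_decreasing_1; lra. }
  intros Hd H0 Hcos. apply Rle_antisym; [now apply Upper|].
  apply Ropp_le_cancel. rewrite Ropp_0. apply (Upper (fun x => - d x)).
  - now apply continuity_opp.
  - rewrite H0; ring.
  - intros x. now rewrite cos_neg.
Qed.

Lemma Im_lnGamma_continuous (L : C -> C) : is_lnGamma L ->
  continuity (fun t => Im (L ((1 / 2)%R, t))).
Proof.
  intros HL t. apply continuity_pt_filterlim.
  assert (HC : @continuous (AbsRing_UniformSpace C_AbsRing) C_UniformSpace L (((1 / 2)%R, t) : C)).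
  { apply (@ex_derive_continuous C_AbsRing C_NormedModule). apply (lnGamma_analytic L HL).
    intros [_ Hre]. simpl in Hre. lra. }
  apply (filterlim_comp _ _ _ (fun t => L ((1 / 2)%R, t)) snd _ (@locally C_UniformSpace (L ((1 / 2)%R, t))));
    [|apply (continuous_snd (U := R_UniformSpace) (V := R_UniformSpace))].
  apply (filterlim_comp _ _ _ (fun t => (((1 / 2)%R, t) : C)) L _
    (@locally (AbsRing_UniformSpace C_AbsRing) (((1 / 2)%R, t) : C))); [|exact HC].
  intros P HP. apply locally_C in HP. destruct HP as [eps HP].
  exists eps. intros y Hy. apply HP. split; [apply ball_center|exact Hy].
Qed.

(** At t = 0 both sides vanish because lnGamma is real on the positive axis; this
    fixes the multiple of 2 PI. *)
Lemma Im_lnGamma_eq_phase (L : C -> C) (t : R) : is_lnGamma L ->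
  Im (L ((1 / 2)%R, t)) = gamma_phase_lim t.
Proof.
  intros HL. symmetry. apply Rminus_diag_uniq.
  apply (continuous_lift_unique (fun x => gamma_phase_lim x - Im (L ((1 / 2)%R, x)))).
  - apply continuity_minus; [apply gamma_phase_lim_continuous|now apply Im_lnGamma_continuous].
  - rewrite gamma_phase_lim_at_0.
    destruct (lnGamma_real L HL (1 / 2) ltac:(lra)) as [g [_ E]].
    unfold RtoC in E. rewrite E. simpl. ring.
  - intros x. apply (gamma_phase_congruent x (Re (L ((1 / 2)%R, x)))).
    pose proof (lnGamma_exp L HL ((1 / 2)%R, x)) as H.
    assert (Hs : slit_plane ((1 / 2)%R, x)) by (intros [_ Hre]; simpl in Hre; lra).
    specialize (H Hs). destruct (L ((1 / 2)%R, x)). exact H.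
Qed.

(** * Terms and remainder on the imaginary axis *)

Lemma Clog_imag (t : R) : 0 < t -> Clog (Ci * t) = (ln t, PI / 2).
Proof.
  intros Ht. assert (E : (Ci * t)%C = (0, t)) by (unfold Ci, Cmult, RtoC; simpl; f_equal; ring).
  rewrite E. unfold Clog, Carg. simpl Im. simpl Re.
  destruct (Rle_dec 0 t) as [_|]; [|lra].
  replace (Cmod (0, t)) with t.
  - unfold Rdiv. rewrite Rmult_0_l, acos_0. reflexivity.
  - unfold Cmod; simpl. replace (0 * (0 * 1) + t * (t * 1)) with (t * t) by ring.
    symmetry; apply sqrt_square; lra.
Qed.

Lemma imag_pow_odd (t : R) (l : nat) :
  ((Ci * t) ^ S (2 * l))%C = (0, (-1) ^ l * t ^ S (2 * l)).
Proof.
  assert (E : (Ci * t)%C = (0, t)) by (unfold Ci, Cmult, RtoC; simpl; f_equal; ring).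
  rewrite E. induction l as [|l IH].
  - simpl. unfold Cmult, RtoC; simpl. f_equal; ring.
  - replace (S (2 * S l)) with (S (S (S (2 * l)))) by lia.
    transitivity ((0, t) * ((0, t) * (0, t) ^ S (2 * l)))%C; [reflexivity|].
    rewrite IH. unfold Cmult; simpl. f_equal; ring.
Qed.

Lemma Im_That_imag (j : nat) (t : R) : 0 < t -> (1 <= j)%nat ->
  Im (That j (Ci * t)) = That_im j t.
Proof.
  intros Ht Hj. unfold That, That_im. rewrite (proj1 (bernoulli_half_abs j Hj)).
  destruct j as [|l]; [lia|]. replace (2 * S l - 1)%nat with (S (2 * l)) by lia.
  rewrite imag_pow_odd.
  assert (HJ : 1 <= INR (S l)) by (apply (le_INR 1); lia).
  assert (Hp : 0 < t ^ S (2 * l)) by now apply pow_lt.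
  set (b := bernoulli_poly _ _). set (J := INR (S l)) in *. set (q := t ^ S (2 * l)) in *.
  assert (Hs : (-1) ^ l * (-1) ^ l = 1).
  { rewrite <- Rpow_mult_distr. replace (-1 * -1) with 1 by ring. apply pow1. }
  simpl ((-1) ^ S l). set (s := (-1) ^ l) in *. clearbody b J q s.
  assert (Hs0 : s <> 0) by (intros ->; lra).
  set (c := 2 * J * (2 * J - 1)). assert (Hc : 0 < c) by (unfold c; nra).
  unfold Cdiv, Cmult, Cinv, RtoC; simpl.
  transitivity (- b / (c * s * q)).
  - field. repeat split; try lra.
  - apply Rmult_eq_reg_r with (c * q); [|nra].
    transitivity (- b * (s * s) / s); [rewrite Hs|]; field; repeat split; lra.
Qed.

Lemma Im_sum_n_m (u : nat -> C) (k : nat) :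
  Im (@sum_n_m C_AbelianMonoid u 1 k) = sum_n_m (fun j => Im (u j)) 1 k.
Proof.
  induction k as [|k IH].
  - rewrite !sum_n_m_zero by lia. reflexivity.
  - rewrite !sum_n_Sm by lia. rewrite <- IH. reflexivity.
Qed.

(** Since log (it) = ln t + i PI/2, the imaginary part of z log z - z at z = it is
    t ln t - t. *)
Lemma Rtilde_eq (L : C -> C) (t : R) (k : nat) : is_lnGamma L -> 0 < t ->
  Rtilde L (k + 1) t
  = 1 / 2 * (gamma_phase_lim t - (t * ln t - t + sum_n_m (fun j => That_im j t) 1 k)).
Proof.
  intros HL Ht. unfold Rtilde, Rhat. rewrite Clog_imag by exact Ht.
  replace (k + 1 - 1)%nat with k by lia.
  rewrite <- (Im_lnGamma_eq_phase L t HL).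
  replace (Ci * t + RtoC (1 / 2))%C with (((1 / 2)%R, t) : C)
    by (unfold Ci, Cmult, Cplus, RtoC; simpl; f_equal; ring).
  replace (sum_n_m (fun j => That_im j t) 1 k) with
    (Im (@sum_n_m C_AbelianMonoid (fun j => That j (Ci * t)) 1 k)).
  2: { rewrite Im_sum_n_m. apply sum_n_m_ext_loc. intros j Hj. apply Im_That_imag; [exact Ht|lia]. }
  set (w := L _). set (S := @sum_n_m _ _ _ _). clearbody w S.
  destruct w as [w1 w2]. destruct S as [S1 S2].
  unfold Ci, Cmult, Cminus, Cplus, Copp, RtoC; simpl. ring.
Qed.

Lemma Ttilde_eq (j : nat) (t : R) : 0 < t -> (1 <= j)%nat -> Ttilde j t = 1 / 2 * That_im j t.
Proof.
  intros Ht Hj. unfold Ttilde, That_im, That. f_equal.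
  assert (HJ : 1 <= INR j) by (apply (le_INR 1); lia).
  assert (Hp : 0 < t ^ (2 * j - 1)) by now apply pow_lt.
  rewrite <- RtoC_pow, <- RtoC_mult, <- RtoC_div.
  - rewrite Cmod_R. unfold Rdiv at 1. rewrite Rabs_mult. rewrite (Rabs_pos_eq (/ _)); [reflexivity|].
    apply Rlt_le, Rinv_0_lt_compat. apply Rmult_lt_0_compat; nra.
  - apply Rgt_not_eq, Rmult_lt_0_compat; nra.
Qed.

Theorem corollary3 (lnGamma : C -> C) (HlnGamma : is_lnGamma lnGamma)
    (t : R) (k : nat) (ht : 0 < t) (hk : (1 <= k)%nat) :
  Rabs (Rtilde lnGamma (k + 1) t / Ttilde k t) < eta k * sqrt (PI * INR k).
Proof.
  rewrite Rtilde_eq, Ttilde_eq by assumption.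
  pose proof (gamma_phase_limit_bound t _ k ht hk (gamma_phase_converges t)) as HB.
  set (E := gamma_phase_lim t - _) in *.
  destruct (bernoulli_half_abs k hk) as [_ HbP].
  rewrite <- (eta_bernoulli k hk) in HB.
  unfold That_im. set (b := Rabs (bernoulli_poly (2 * k) (1 / 2))) in *.
  assert (HK : 1 <= INR k) by (apply (le_INR 1); lia).
  assert (Hp : 0 < t ^ (2 * k - 1)) by now apply pow_lt. set (q := t ^ (2 * k - 1)) in *.
  assert (Heta : 0 < eta k).
  { apply Rmult_lt_reg_r with b; [exact HbP|]. rewrite Rmult_0_l.
    unfold b. rewrite eta_bernoulli by exact hk. apply Rabs_pos_lt. intros E0.
    pose proof (bernoulli_even_sign k hk) as Hs. rewrite E0 in Hs. lra. }
  assert (Hden : 0 < 1 / 2 * (b / (2 * INR k * (2 * INR k - 1) * q))).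
  { apply Rmult_lt_0_compat; [lra|]. apply Rdiv_lt_0_compat; [exact HbP|].
    repeat apply Rmult_lt_0_compat; lra. }
  unfold Rdiv at 1.
  rewrite Rabs_mult, Rabs_mult, Rabs_inv, (Rabs_pos_eq (1 / 2)), (Rabs_pos_eq (1 / 2 * _)) by lra.
  apply Rlt_div_l; [exact Hden|].
  destruct k as [|l]; [lia|].
  pose proof (wallis_bound l) as HW. replace (2 * S l - 2)%nat with (2 * l)%nat in HB by lia.
  replace (INR (S (2 * l))) with (2 * INR (S l) - 1) in HW
    by (rewrite !S_INR, mult_INR; simpl (INR 2); ring).
  set (K := INR (S l)) in *.
  apply Rle_lt_trans with (1 / 2 * (eta (S l) * b / (2 * K * q) * wallis (2 * l))); [lra|].
  replace (1 / 2 * (eta (S l) * b / (2 * K * q) * wallis (2 * l))) with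
    (eta (S l) * ((2 * K - 1) * wallis (2 * l)) * (1 / 2 * (b / (2 * K * (2 * K - 1) * q)))).
  2: { field. repeat split; lra. }
  apply Rmult_lt_compat_r; [exact Hden|]. now apply Rmult_lt_compat_l.
Qed.
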